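(* Let $P\in\mathcal S(\pi)$ be compact on $L^2(\pi)$, let $G$ be a locally compact topological group with Haar measure $\mu$ acting on $\mathcal X$, and assume $\pi$ is $G$-invariant. Let $\gamma(P)=\lambda(\sqrt{PP^*})$ be the multiplicative spectral gap and let $\gamma_2(P)$ be the next smallest eigenvalue after $\gamma(P)$ of $I-\sqrt{PP^*}$ (the smallest eigenvalue strictly larger than $\gamma(P)$, assumed to exist where it is used), and analogously for $\gamma_2(P^* )$ with $I-\sqrt{P^*P}$. Then: (i) For any probability measure $\nu$ on $G\times G$, $\gamma(P_{da}(G,\nu))\ge\gamma(P)$ and $\lambda(P_{da}(G,\nu))\ge\gamma(P)$. (ii) In particular, $\gamma((P_{la})_{ra})\ge\max\{\gamma(P_{la}),\gamma(P_{ra})\}$. Moreover, $$\gamma(P_{la})\ge 1-\sqrt{\beta(1-\gamma(P))^2+(1-\beta)(1-\gamma_2(P))^2}\ge\gamma(P),$$ where $\beta:=\|\mathbf P_V\mathbf P_{\widetilde W(P)}\mathbf P_V\|_{2\to2}$, and $\gamma(P_{la})>\gamma(P)$ if $\widetilde W(P)\cap V=\{0\}$. Similarly, $$\gamma(P_{ra})\ge 1-\sqrt{\beta'(1-\gamma(P))^2+(1-\beta')(1-\gamma_2(P))^2}\ge\gamma(P),$$ where $\beta':=\|\mathbf P_V\mathbf P_{\widetilde W(P^* )}\mathbf P_V\|_{2\to2}$, and $\gamma(P_{ra})>\gamma(P)$ if $\widetilde W(P^* )\cap V=\{0\}$.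
   Context: $\mathcal X$ is a Polish space with its $\sigma$-algebra $\mathcal F$; $\pi$ is a probability measure on $\mathcal X$; a Markov kernel $P$ acts by $P[f](x)=\int f(y)P(x,dy)$. $\mathcal S(\pi)$ is the set of Markov kernels with $\pi P=\pi$, viewed as bounded operators on the real Hilbert space $L^2(\pi)$ (inner product $\langle\cdot,\cdot\rangle_\pi$, norm $\|\cdot\|_\pi$), with adjoint $P^*$. $L^2_0(\pi)=\{f\in L^2(\pi):\langle f,\mathbf 1\rangle_\pi=0\}$ and $\|T\|_{2\to2}=\sup\{\|T[f]\|_\pi:f\in L_0^2(\pi),\|f\|_\pi=1\}$. $G$ acts measurably on $\mathcal X$; $\mu$ is normalized to be a probability measure. $U_g[f](x)=f(gx)$. $\pi$ is $G$-invariant if $\pi(gA)=\pi(A)$ for all $g\in G,A\in\mathcal F$. Standing assumption: $\pi$ has a density with respect to a reference measure $\mathfrak m$ on $\mathcal X$, and $\mathfrak m$ is invariant under every $g\in G$. For a probability measure $\nu$ on $G\times G$: $P_{da}(G,\nu)=\mathbb E_{(g,h)\sim\nu}(U_gPU_h)$. $P_{la}=\mathbb E_{g\sim\mu}(U_gP)$, $P_{ra}=\mathbb E_{g\sim\mu}(PU_g)$, $(P_{la})_{ra}=\mathbb E_{(g,h)\sim\mu\otimes\mu}(U_gPU_h)$. For an operator $T$, $\lambda(T)=\inf\{\langle f,(I-T)[f]\rangle_\pi:f\in L_0^2(\pi),\|f\|_\pi=1\}$, and $\gamma(T)=\lambda(\sqrt{TT^*})$. $V=\{f\in L^2(\pi):U_g[f]=f\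 \forall g\in G\}$, $\widetilde W(P)=\{f\in L^2(\pi):(I-\sqrt{PP^*})f=\gamma(P)f\}$ and $\widetilde W(P^* )=\{f\in L^2(\pi):(I-\sqrt{P^*P})f=\gamma(P^* )f\}$. $\mathbf P_\Omega$ is the orthogonal projection of $L^2(\pi)$ onto a closed subspace $\Omega$. *)

(* Defs.v *)
From HB Require Import structures.
From mathcomp Require Import all_boot all_order all_algebra.
From mathcomp Require Import all_classical all_reals all_analysis.
From mathcomp Require Import measurable_realfun ess_sup_inf.

Set Implicit Arguments.
Unset Strict Implicit.
Unset Printing Implicit Defensive.

Import Order.TTheory GRing.Theory Num.Theory.
Import numFieldNormedType.Exports.

Local Open Scope classical_set_scope.
Local Open Scope ring_scope.

(* [LspaceType mu p1] is the library's L^p space, whose elements are classes of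
   a.e. equal functions (the coercion to functions picks a representative); the
   library gives it neither the vector space structure nor the norm. *)
Section LspaceNormed.
Context d (T : measurableType d) (R : realType).
Variables (mu : {measure set T -> \bar R}) (p : \bar R) (p1 : (1 <= p)%E).
Local Notation Lsp := (LspaceType mu p1).
Local Notation Lfn := (LfunType mu p1).

HB.instance Definition _ := gen_eqMixin Lsp.
HB.instance Definition _ := gen_choiceMixin Lsp.

Lemma LspaceP (u v : Lsp) : (u : T -> R) = v %[ae mu] -> u = v.
Proof.
case: u v => [u [[uf]]] [v [[vf]]] /= uv.
have E : u = v by apply/eqP; rewrite -[u]reprK -[v]reprK; exact/ae_eqP.
move: uf vf; rewrite E => uf vf; congr LebesgueSpace.Pack.
by congr LebesgueSpace.Class; congr isFinLebesgue.Axioms_; exact: Prop_irrelevance.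
Qed.

Lemma eq_ae_Lnorm (f g : T -> R) : measurable_fun [set: T] f ->
  measurable_fun [set: T] g -> f = g %[ae mu] ->
  'N[mu]_p[EFin \o f]%E = 'N[mu]_p[EFin \o g]%E.
Proof.
move=> mf mg fg; have r0 : (0 < p)%E by apply: lt_le_trans p1; rewrite lte01.
rewrite unlock /Lnorm; case: p p1 r0 => [r r1 r0|_ _|//]; last first.
  case: ifPn => // _; apply: eq_ess_sup.
  by apply: filterS fg => x /= ->.
have mpow (h : T -> R) : measurable_fun [set: T] h ->
    measurable_fun [set: T] (fun x => `|(EFin \o h) x| `^ r)%E.
  move=> mh0; have mh : measurable_fun [set: T] (fun x => `|(EFin \o h) x|)%E.
    by apply: measurableT_comp => //; exact/measurable_EFinP.
  exact: (measurableT_comp (measurable_poweR r) mh).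
congr poweR; apply: ae_eq_integral => //; [exact: mpow|exact: mpow|].
by apply: filterS fg => x + _ /= => ->.
Qed.

Lemma Lspace_Lfun (u : Lsp) : (u : T -> R) \in Lfun mu p.
Proof.
rewrite inE; apply/andP; split.
  by rewrite inE /=; exact: (measurable_funPT (repr (LebesgueSpace.sort u))).
by rewrite inE /=; case: u => u [[]].
Qed.

Definition Lfun_of_Lspace (u : Lsp) : Lfn := Lfun_Sub p1 (Lspace_Lfun u).

Section class_of.
Variable f : Lfn.
Let mf : measurable_fun [set: T] (f : T -> measurableTypeR R).
Proof. exact: (measurable_funPT f). Qed.
Let f' : {mfun T >-> measurableTypeR R} :=
  HB.pack_for {mfun T >-> measurableTypeR R} (f : T -> R)
    (isMeasurableFun.Build _ _ T (measurableTypeR R) f mf).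
Let c : {mfun_ mu, T >-> measurableTypeR R} :=
  \pi_{mfun_ mu, T >-> measurableTypeR R}%qT f'.

Let cE : (c : T -> R) = f %[ae mu].
Proof.
have /eqmodP/asboolP// : (repr c = f' %[mod {mfun_ mu, T >-> measurableTypeR R}])%qT.
by rewrite reprK.
Qed.

Let c_fin : finite_norm mu p c.
Proof.
rewrite /finite_norm (@eq_ae_Lnorm c f)//; first exact: Lfunction_finite.
exact: (measurable_funPT (repr c)).
Qed.

Definition Lspace_class : Lsp :=
  LebesgueSpace.Pack (LebesgueSpace.Class (isFinLebesgue.Build _ _ _ _ _ p1 c c_fin)).

Lemma Lspace_classE : (Lspace_class : T -> R) = f %[ae mu].
Proof. exact: cE. Qed.
End class_of.

Lemma Lspace_classK (u : Lsp) : Lspace_class (Lfun_of_Lspace u) = u.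
Proof. by apply: LspaceP; exact: Lspace_classE. Qed.

Lemma Lspace_class_eq (f g : Lfn) :
  (f : T -> R) = g %[ae mu] -> Lspace_class f = Lspace_class g.
Proof.
move=> fg; apply: LspaceP; move: (Lspace_classE f) (Lspace_classE g) fg.
by apply: filterS3 => x + + + _ => -> // -> // ->.
Qed.

Let add (u v : Lsp) := Lspace_class (Lfun_of_Lspace u + Lfun_of_Lspace v).
Let opp (u : Lsp) := Lspace_class (- Lfun_of_Lspace u).
Let scale (a : R) (u : Lsp) := Lspace_class (a *: Lfun_of_Lspace u).

Let addE u v : (add u v : T -> R) = (fun x => u x + v x) %[ae mu].
Proof. exact: Lspace_classE. Qed.

Let oppE u : (opp u : T -> R) = (fun x => - u x) %[ae mu].
Proof. exact: Lspace_classE. Qed.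

Let zeroE : (Lspace_class 0 : T -> R) = (fun=> 0) %[ae mu].
Proof. exact: Lspace_classE. Qed.

Let scaleE a u : (scale a u : T -> R) = (fun x => a * u x) %[ae mu].
Proof. exact: Lspace_classE. Qed.

Let addA : associative add.
Proof.
move=> u v w; apply: LspaceP.
near=> x => _; rewrite (near (addE u (add v w)) x)// (near (addE v w) x)//.
by rewrite (near (addE (add u v) w) x)// (near (addE u v) x)// addrA.
Unshelve. all: by end_near. Qed.

Let addC : commutative add.
Proof. by move=> u v; rewrite /add addrC. Qed.

Let add0 : left_id (Lspace_class 0) add.
Proof.
move=> u; apply: LspaceP; near=> x => _.
by rewrite (near (addE (Lspace_class 0) u) x)// (near zeroE x)// add0r.
Unshelve. all: by end_near. Qed.

Let addN : left_inverse (Lspace_class 0) opp add.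
Proof.
move=> u; apply: LspaceP; near=> x => _.
rewrite (near (addE (opp u) u) x)// (near (oppE u) x)// (near zeroE x)//.
by rewrite addNr.
Unshelve. all: by end_near. Qed.

HB.instance Definition _ := GRing.isZmodule.Build Lsp addA addC add0 addN.

Lemma Lspace0E : ((0 : Lsp) : T -> R) = (fun=> 0) %[ae mu].
Proof. exact: zeroE. Qed.

Lemma LspaceDE (u v : Lsp) :
  ((u + v : Lsp) : T -> R) = (fun x => u x + v x) %[ae mu].
Proof. exact: addE. Qed.

Lemma LspaceNE (u : Lsp) : ((- u : Lsp) : T -> R) = (fun x => - u x) %[ae mu].
Proof. exact: oppE. Qed.

Let scaleA a b u : scale a (scale b u) = scale (a * b) u.
Proof.
apply: LspaceP; near=> x => _.
rewrite (near (scaleE a (scale b u)) x)// (near (scaleE b u) x)//.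
by rewrite (near (scaleE (a * b) u) x)// mulrA.
Unshelve. all: by end_near. Qed.

Let scale1 : left_id 1 scale.
Proof.
by move=> u; apply: LspaceP; near=> x => _; rewrite (near (scaleE 1 u) x)// mul1r.
Unshelve. all: by end_near. Qed.

Let scaleDr : right_distributive scale +%R.
Proof.
move=> a u v; apply: LspaceP; near=> x => _.
rewrite (near (scaleE a (u + v)) x)// (near (LspaceDE u v) x)//.
rewrite (near (LspaceDE (scale a u) (scale a v)) x)//.
by rewrite (near (scaleE a u) x)// (near (scaleE a v) x)// mulrDr.
Unshelve. all: by end_near. Qed.

Let scaleDl u : {morph scale^~ u : a b / a + b}.
Proof.
move=> a b; apply: LspaceP; near=> x => _.
rewrite (near (scaleE (a + b) u) x)// (near (LspaceDE (scale a u) (scale b u)) x)//.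
by rewrite (near (scaleE a u) x)// (near (scaleE b u) x)// mulrDl.
Unshelve. all: by end_near. Qed.

HB.instance Definition _ :=
  GRing.Zmodule_isLmodule.Build R Lsp scaleA scale1 scaleDr scaleDl.

Lemma LspaceZE a (u : Lsp) :
  ((a *: u : Lsp) : T -> R) = (fun x => a * u x) %[ae mu].
Proof. exact: scaleE. Qed.

Let norm (u : Lsp) : R := fine ('N[mu]_p[EFin \o u])%E.

Let norm_class (f : Lfn) : norm (Lspace_class f) = fine ('N[mu]_p[EFin \o f])%E.
Proof.
rewrite /norm (@eq_ae_Lnorm _ f) //; last exact: Lspace_classE.
exact: (measurable_funPT (repr (LebesgueSpace.sort (Lspace_class f)))).
Qed.

Let ler_normD u v : norm (u + v) <= norm u + norm v.
Proof. by rewrite [leLHS]norm_class; exact: ler_LnormD. Qed.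

Let normrZ a u : norm (a *: u) = `|a| * norm u.
Proof.
by rewrite [LHS]norm_class; apply: EFin_inj;
  rewrite finite_norm_fine LnormZ EFinM -(finite_norm_fine (Lfun_of_Lspace u)).
Qed.

Let normr0_eq0 u : norm u = 0 -> u = 0.
Proof.
move=> u0; apply: LspaceP; near=> x => _; rewrite (near Lspace0E x)//.
exact: (near (@fine_Lnormr_eq0 _ _ _ _ _ _ (Lfun_of_Lspace u) u0) x).
Unshelve. all: by end_near. Qed.

HB.instance Definition _ :=
  Lmodule_isNormed.Build R Lsp ler_normD normrZ normr0_eq0.

Lemma LspaceNormE (u : Lsp) : `|u| = fine ('N[mu]_p[EFin \o u])%E.
Proof. by []. Qed.
End LspaceNormed.

Notation L2 pi := (LspaceType pi (lee1n 2)).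

Section L2Operators.
Context d (T : measurableType d) (R : realType) (pi : probability T R).
Implicit Types (f h : L2 pi) (A B : L2 pi -> L2 pi) (W : set (L2 pi)).

Definition dotp f h : R := (\int[pi]_x (f x * h x))%R.

(* The class of [F]; [0] if [F] is not a.e. equal to an element of L^2. *)
Definition L2class (F : T -> R) : L2 pi :=
  xget 0 [set f : L2 pi | (f : T -> R) = F %[ae pi]].

Definition L20 : set (L2 pi) := [set f | dotp f (L2class (fun=> 1)) = 0].

Definition L20_sphere : set (L2 pi) := [set f | L20 f /\ `|f| = 1].

Definition bounded_operator A := linear A /\ continuous A.

Definition compact_operator A :=
  bounded_operator A /\ precompact (A @` [set f | `|f| <= 1]).

Definition opnorm0 A : R := sup [set `|A f| | f in L20_sphere].

(* Adjoints, square roots, projections and expectations of operators are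
   determined uniquely by the properties given; [fun=> 0] is the value when no
   operator has them. *)
Definition adjoint A : L2 pi -> L2 pi :=
  xget (fun=> 0) [set B | bounded_operator B /\
    forall f h, dotp (A f) h = dotp f (B h)].

Definition sqrt_operator A : L2 pi -> L2 pi :=
  xget (fun=> 0) [set S | [/\ bounded_operator S,
    forall f h, dotp (S f) h = dotp f (S h),
    forall f, 0 <= dotp f (S f) &
    S \o S = A]].

Definition orth_proj W : L2 pi -> L2 pi :=
  xget (fun=> 0) [set Q | forall f, W (Q f) /\
    forall h, W h -> dotp (f - Q f) h = 0].

(* The weak integral of [A] against [nu]. *)
Definition Eoperator d' (O : measurableType d') (nu : {measure set O -> \bar R})
    (A : O -> L2 pi -> L2 pi) : L2 pi -> L2 pi :=
  xget (fun=> 0) [set B | bounded_operator B /\ forall f h,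
    nu.-integrable [set: O] (fun w => (dotp (A w f) h)%:E) /\
    dotp (B f) h = (\int[nu]_w dotp (A w f) h)%R].

Definition lambda_gap A : R := inf [set dotp f (f - A f) | f in L20_sphere].

Definition mult_sqrt A := sqrt_operator (A \o adjoint A).

Definition gamma_gap A : R := lambda_gap (mult_sqrt A).

Definition Wtilde A : set (L2 pi) :=
  [set f | f - mult_sqrt A f = gamma_gap A *: f].

Definition is_eigenvalue A (c : R) := exists2 f, f != 0 & A f = c *: f.

Definition is_gamma2 A (c : R) :=
  [/\ is_eigenvalue (fun f => f - mult_sqrt A f) c,
      gamma_gap A < c &
      forall c', is_eigenvalue (fun f => f - mult_sqrt A f) c' ->
        gamma_gap A < c' -> c <= c'].

Definition kernel_operator (P : R.-pker T ~> T) : L2 pi -> L2 pi :=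
  fun f => L2class (fun x => (\int[P x]_y f y)%R).

Definition stationary (P : R.-pker T ~> T) :=
  forall E, measurable E -> (\int[pi]_x P x E)%E = pi E.

End L2Operators.
Arguments kernel_operator {d T R} pi P _.

Notation borel X := (g_sigma_algebraType (@open X)).

Definition polish (R : realType) (X : topologicalType) :=
  (exists2 D : set X, countable D & dense D) /\
  exists dist : X -> X -> R,
    [/\ forall x y, dist x y = 0 <-> x = y,
        forall x y, dist x y = dist y x,
        forall x y z, dist x z <= dist x y + dist y z,
        forall x A, nbhs x A <->
          exists2 e : R, 0 < e & [set y | dist x y < e] `<=` A &
        forall u : nat -> X,
          (forall e : R, 0 < e -> exists N : nat, forall m n, (N <= m)%N -> (N <= n)%N ->
            dist (u m) (u n) < e) ->
          exists l : X, u @ \oo --> l].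

HB.mixin Record Group_Topological_isTopologicalGroup G
    & Group G & PointedTopological G := {
  mulg_continuous : continuous (fun xy : G * G => (xy.1 * xy.2)%g);
  invg_continuous : continuous (fun x : G => x^-1%g)
}.

(* The (arbitrary) point is what the library asks of a measurable type. *)
#[short(type="topologicalGroupType")]
HB.structure Definition TopologicalGroup :=
  {G of Group G & PointedTopological G & Group_Topological_isTopologicalGroup G}.

Definition haar_measure (R : realType) (G : topologicalGroupType)
    (mu : {measure set (borel G) -> \bar R}) :=
  [/\ mu setT != 0%E,
      forall K : set G, compact K -> (mu K < +oo)%E,
      forall (g : G) (A : set (borel G)), measurable A ->
        mu [set (g * x)%g | x in A] = mu A,
      forall A : set (borel G), measurable A ->
        mu A = ereal_inf [set mu O | O in [set O : set G | open O /\ A `<=` O]] &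
      forall O : set G, open O ->
        mu O = ereal_sup [set mu K | K in [set K : set G | compact K /\ K `<=` O]]].

Definition has_density (R : realType) d (T : measurableType d)
    (m : {measure set T -> \bar R}) (nu : {measure set T -> \bar R}) :=
  exists2 q : T -> R, measurable_fun [set: T] q /\ (forall x, 0 <= q x) &
    forall A, measurable A -> nu A = (\int[m]_(x in A) (q x)%:E)%E.

Section GroupAction.
Context (R : realType) (X : ptopologicalType) (G : topologicalGroupType).
Variable act : G -> X -> X.

Definition measurable_action :=
  [/\ forall x, act 1%g x = x,
      forall g h x, act (g * h)%g x = act g (act h x) &
      measurable_fun [set: borel G * borel X]
        (fun gx : borel G * borel X => act gx.1 gx.2 : borel X)].

Definition invariant_measure (m : {measure set (borel X) -> \bar R}) :=
  forall (g : G) (A : set (borel X)), measurable A -> m [set act g x | x in A] = m A.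

Variable pi : probability (borel X) R.
Implicit Type A : L2 pi -> L2 pi.

Definition Uop (g : G) : L2 pi -> L2 pi := fun f => L2class pi (fun x => f (act g x)).

Definition Vspace : set (L2 pi) := [set f | forall g, Uop g f = f].

(* A measure on [G * G] is one on the product of the two Borel sigma-algebras. *)
Definition Pda (nu : {measure set (borel G * borel G) -> \bar R}) A :=
  Eoperator nu (fun gh => Uop gh.1 \o A \o Uop gh.2).

Definition Plara (mu : probability (borel G) R) A :=
  Pda (mu \x mu)%E A.

Definition Pla (mu : {measure set (borel G) -> \bar R}) A :=
  Eoperator mu (fun g => Uop g \o A).

Definition Pra (mu : {measure set (borel G) -> \bar R}) A :=
  Eoperator mu (fun g => A \o Uop g).

Definition beta (W : set (L2 pi)) : R :=
  opnorm0 (orth_proj Vspace \o orth_proj W \o orth_proj Vspace).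

End GroupAction.
Arguments Vspace {R X G} act pi _.

(* Main.v *)
(* Riesz's representation theorem in the complete space L^2(pi) gives adjoints and
   weak integrals of operators, and the iteration Y -> ((I - A) + Y^2) / 2 gives
   square roots. For a contraction A that fixes the constants, sqrt(A A') and the adjoint A'
   have the same norm at each vector, so gamma(A) = 1 - ||A'|| = 1 - ||A|| on L^2_0,
   and (i) follows because U_g is an isometry that fixes the constants.

   For (ii), left invariance of mu shows that Q = E(U_g) is the orthogonal projection
   onto V, and P_la = Q P, P_ra = P Q = (Q P')', (P_la)_ra = Q P Q. The bound on
   gamma(Q A) then comes from the size of S = sqrt(A A') on V: S is 1 - gamma(A) on
   W, the compactness of A makes it at most 1 - gamma_2 on the orthogonal complement
   of W in L^2_0, and beta bounds the W-component of a unit vector of V. *)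
Require Import Defs.
From HB Require Import structures.
From mathcomp Require Import all_boot all_order all_algebra.
From mathcomp Require Import all_classical all_reals all_analysis.
From mathcomp Require Import measurable_realfun ring lra.
Import Order.TTheory GRing.Theory Num.Theory.
Import numFieldNormedType.Exports.
Local Open Scope classical_set_scope.
Local Open Scope ring_scope.

Set Implicit Arguments.
Unset Strict Implicit.
Unset Printing Implicit Defensive.

(** * Hilbert spaces *)

(** The spectral information comes from maximizing sequences. The norm of [S] on the orthogonal
    complement of W in L^2_0 is attained at an eigenvector there, which cannot lie in W, so the
    minimality of gamma_2 bounds its eigenvalue. The strict inequality uses the same argument on V,
    which [S] need not preserve: near-maximizers in V are approximate eigenvectors because the bound
    holds on all of L^2_0, and their limit stays in V because V is closed. The gap controls only the
    quadratic form of [S]; Cauchy-Schwarz for that form turns this into a bound on norms. One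
    gamma_2 serves both sides: T T' and T' T have the same nonzero eigenvalues. The eigenvalue 0 of
    these products, that is c = 1 for I - S, need not transfer, so minimality is invoked only for c
    < 1. Compactness enters only through S^2 = A A', which is compact both for A = T and for A =
    T'. *)

Section LinearMap.
Context (R : pzRingType) (U V : lmodType R) (A : U -> V).
Hypothesis linA : linear A.

Lemma lin0 : A 0 = 0.
Proof. by have := linA (-1) 0 0; rewrite scaler0 addr0 scaleN1r addNr. Qed.

Lemma linD u v : A (u + v) = A u + A v.
Proof. by rewrite -[u]scale1r linA !scale1r. Qed.

Lemma linZ a u : A (a *: u) = a *: A u.
Proof. by rewrite -[a *: u]addr0 linA lin0 addr0. Qed.

Lemma linN u : A (- u) = - A u.
Proof. by rewrite -scaleN1r linZ scaleN1r. Qed.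

Lemma linB u v : A (u - v) = A u - A v.
Proof. by rewrite linD linN. Qed.
End LinearMap.

Section BoundedLinear.
Context (R : realType) (V W : normedModType R) (A : V -> W).
Hypothesis linA : linear A.

Lemma bounded_lin_continuous (M : R) :
  (forall u, `|A u| <= M * `|u|) -> continuous A.
Proof.
move=> AM u; apply/cvgrPdist_lt => e e0.
(* [M] may be zero or negative, so [|M| + 1] is the denominator. *)
have M1 : 0 < `|M| + 1 by rewrite ltr_wpDl.
have : \forall x \near u, `|u - x| < e / (`|M| + 1).
  by apply: cvgr_dist_lt; [exact: cvg_id|rewrite divr_gt0].
apply: filterS => x ux; rewrite -(linB linA) (le_lt_trans (AM _))//.
rewrite (le_lt_trans (ler_wpM2r _ (ler_norm M)))//.
apply: (@le_lt_trans _ _ ((`|M| + 1) * `|u - x|)); first by rewrite ler_wpM2r// lerDl.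
by rewrite mulrC -ltr_pdivlMr.
Qed.

Lemma continuous_lin_bounded : continuous A ->
  exists M : R, forall u, `|A u| <= M * `|u|.
Proof.
move=> Ac.
have Ac0 : A x @[x --> (0 : V)] --> A 0 by exact: Ac.
move/cvgr_dist_lt : Ac0 => /(_ 1 ltr01); rewrite (lin0 linA).
move=> /nbhs_normP[e /= e0 eP]; exists (2 / e) => u.
have [->|u0] := eqVneq u 0; first by rewrite (lin0 linA) !normr0 mulr0.
have un : 0 < `|u| by rewrite normr_gt0.
pose c := e / 2 / `|u|.
have c0 : 0 < c by rewrite !divr_gt0.
have : `|0 - A (c *: u)| < 1.
  apply: eP; rewrite /ball_/= sub0r normrN normrZ gtr0_norm// divfK ?gt_eqF//.
  by rewrite ltr_pdivrMr// ltr_pMr// ltr1n.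
rewrite sub0r normrN (linZ linA) normrZ gtr0_norm// mulrC -ltr_pdivlMr// => /ltW.
rewrite /c; suff -> : 1 / (e / 2 / `|u|) = 2 / e * `|u| by [].
by field; rewrite !gt_eqF.
Qed.
End BoundedLinear.

(** A property of a pairing on a space that already carries its norm, so that it can be proved of
    [dotp] on [L2 pi]; [dot_norm] ties the two together. *)
Record hilbert_dot (R : realType) (H : normedModType R) (dot : H -> H -> R) :
    Prop := HilbertDot {
  dotC : forall u v, dot u v = dot v u ;
  dotDZl : forall a u v w, dot (a *: u + v) w = a * dot u w + dot v w ;
  dot_norm : forall u, dot u u = `|u| ^+ 2 ;
  dot_complete : forall u : nat -> H,
    (forall e : R, 0 < e -> exists N : nat, forall m n, (N <= m)%N -> (N <= n)%N ->
      `|u m - u n| < e) ->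
    exists l : H, u @ \oo --> l }.

Section Hilbert.
Context (R : realType) (H : normedModType R) (dot : H -> H -> R).
Hypothesis hdot : hilbert_dot dot.
Implicit Types (u v w f g h : H) (a b c e M : R) (A B S : H -> H).

Let dC : forall u v, dot u v = dot v u := dotC hdot.

Lemma dotDl u v w : dot (u + v) w = dot u w + dot v w.
Proof. by rewrite -[u]scale1r (dotDZl hdot) mul1r scale1r. Qed.

Lemma dot0l w : dot 0 w = 0.
Proof.
have := dotDZl hdot (-1) 0 0 w.
by rewrite scaler0 addr0 mulN1r addNr.
Qed.

Lemma dotZl a u w : dot (a *: u) w = a * dot u w.
Proof. by rewrite -[a *: u]addr0 (dotDZl hdot) dot0l addr0. Qed.

Lemma dotNl u w : dot (- u) w = - dot u w.
Proof. by rewrite -scaleN1r dotZl mulN1r. Qed.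

Lemma dotBl u v w : dot (u - v) w = dot u w - dot v w.
Proof. by rewrite dotDl dotNl. Qed.

Lemma dotDr u v w : dot u (v + w) = dot u v + dot u w.
Proof. by rewrite dC dotDl !(dC u). Qed.

Lemma dot0r w : dot w 0 = 0.
Proof. by rewrite dC dot0l. Qed.

Lemma dotZr a u w : dot u (a *: w) = a * dot u w.
Proof. by rewrite dC dotZl dC. Qed.

Lemma dotNr u w : dot u (- w) = - dot u w.
Proof. by rewrite dC dotNl dC. Qed.

Lemma dotBr u v w : dot u (v - w) = dot u v - dot u w.
Proof. by rewrite dotDr dotNr. Qed.

Definition dotE := (dotDl, dotDr, dotNl, dotNr, dotZl, dotZr, dot0l, dot0r).

Lemma dot_ge0 u : 0 <= dot u u.
Proof. by rewrite (dot_norm hdot) exprn_ge0. Qed.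

Lemma dot_eq0 u : (dot u u == 0) = (u == 0).
Proof. by rewrite (dot_norm hdot) sqrf_eq0 normr_eq0. Qed.

Lemma normB_sq u v : `|u - v| ^+ 2 = `|u| ^+ 2 - 2 * dot u v + `|v| ^+ 2.
Proof. by rewrite -!(dot_norm hdot) !dotE (dC v u); ring. Qed.

Lemma pythagoras u v : dot u v = 0 -> `|u + v| ^+ 2 = `|u| ^+ 2 + `|v| ^+ 2.
Proof.
by move=> uv; rewrite -!(dot_norm hdot) !dotE (dC v u) uv; ring.
Qed.

Lemma dot_inj u v : (forall w, dot u w = dot v w) -> u = v.
Proof.
move=> uv; apply/eqP; rewrite -subr_eq0 -dot_eq0.
by rewrite dotBl uv subrr.
Qed.

(** Stated for semidefinite forms: besides [dot] itself it is applied to the form of a positive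
    operator, which may be degenerate. *)
Lemma pos_form_CS (b : H -> H -> R) u v :
  (forall x y, b x y = b y x) ->
  (forall a x y z, b (a *: x + y) z = a * b x z + b y z) ->
  (forall x, 0 <= b x x) -> b u v ^+ 2 <= b u u * b v v.
Proof.
move=> bC bl bp.
have br a x y z : b z (a *: x + y) = a * b z x + b z y.
  by rewrite bC bl !(bC _ z).
have key s t : 0 <= s ^+ 2 * b u u + 2 * s * t * b u v + t ^+ 2 * b v v.
  suff -> : s ^+ 2 * b u u + 2 * s * t * b u v + t ^+ 2 * b v v
      = b (s *: u + (t *: v + 0)) (s *: u + (t *: v + 0)) by exact: bp.
  have b0 z : b 0 z = 0.
    by have := bl (-1) 0 0 z; rewrite scaler0 addr0 mulN1r addNr.
  by rewrite !bl !br !b0 !(bC _ 0) !b0 (bC v u); ring.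
have [bv0|bv0] := eqVneq (b v v) 0.
  rewrite bv0 mulr0; have [->|buv] := eqVneq (b u v) 0; first by rewrite expr0n.
  (* With [b v v = 0] the expression is linear in [t]; this choice makes it equal to
     [- b u v ^+ 2]. *)
  have := key (b u v) (- (b u u + 1) / 2); rewrite bv0 mulr0 addr0.
  rewrite (_ : _ + _ = - (b u v ^+ 2)); last by field.
  by rewrite oppr_ge0 => /le_trans; apply.
have bvp : 0 < b v v by rewrite lt_def bv0 bp.
(* The minimizer of the quadratic, cleared of its denominator. *)
have := key (b v v) (- b u v).
rewrite (_ : _ + _ = b v v * (b u u * b v v - b u v ^+ 2)); last by ring.
by rewrite pmulr_rge0// subr_ge0.
Qed.

Lemma dot_CS u v : `|dot u v| <= `|u| * `|v|.
Proof.
have := @pos_form_CS dot u v dC (dotDZl hdot) dot_ge0.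
rewrite !(dot_norm hdot) -exprMn -[leLHS]real_normK ?num_real//.
by rewrite ler_pXn2r// nnegrE// mulr_ge0.
Qed.

Lemma cvg_normB_le (f : nat -> H) (g : nat -> R) l :
  (forall n, `|f n - l| <= g n) -> g @ \oo --> (0 : R) -> f @ \oo --> l.
Proof.
move=> fg g0; apply: cvg_zero; apply/norm_cvg0P.
apply: (@squeeze_cvgr _ _ _ _ (fun=> 0) g) => //; last exact: cvg_cst.
by near=> n; rewrite normr_ge0 fg.
Unshelve. all: by end_near. Qed.

Lemma cvg_dotl (f : nat -> H) l v :
  f @ \oo --> l -> (fun n => dot (f n) v) @ \oo --> dot l v.
Proof.
move=> fl; apply: cvg_zero; apply/norm_cvg0P.
apply: (@squeeze_cvgr _ _ _ _ (fun=> 0) (fun n => `|f n - l| * `|v|)).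
- near=> n; rewrite normr_ge0 (_ : (_ - _) n = dot (f n - l) v) ?dot_CS//.
  by rewrite dotBl.
- exact: cvg_cst.
- rewrite -[0](mul0r `|v|); apply: cvgM; last exact: cvg_cst.
  rewrite -(@normr0 _ H); apply: cvg_norm; rewrite -(subrr l).
  by apply: cvgB => //; exact: cvg_cst.
Unshelve. all: by end_near. Qed.

Definition closed_subspace (W : set H) :=
  [/\ W 0, forall a u v, W u -> W v -> W (a *: u + v) &
      forall u, (forall e, 0 < e -> exists2 v, W v & `|v - u| < e) -> W u].

Lemma subspaceB W u v : closed_subspace W -> W u -> W v -> W (u - v).
Proof. by move=> [_ Wl _] Wu Wv; rewrite -scaleN1r addrC; exact: Wl. Qed.

Lemma subspaceZ W a u : closed_subspace W -> W u -> W (a *: u).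
Proof. by move=> [W0 Wl _] Wu; rewrite -[_ *: _]addr0; exact: Wl. Qed.

Lemma le_eps a b : (forall e, 0 < e -> a <= b + e) -> a <= b.
Proof. by move=> h; apply/ler_addgt0Pr => e /h. Qed.

(** A sequence in [W] minimizing the distance to [f] is Cauchy by the parallelogram law, since
    midpoints stay in [W]. Its limit is a nearest point, and moving from it along any [h] in [W]
    cannot help, which forces orthogonality. *)
Lemma projection W f : closed_subspace W ->
  exists2 q, W q & forall h, W h -> dot (f - q) h = 0.
Proof.
move=> cW; have [W0 Wl Wc] := cW.
pose D := [set `|f - w| ^+ 2 | w in W].
have D0 : D !=set0 by exists (`|f - 0| ^+ 2), 0.
have Dlb : has_lbound D by exists 0 => _ [w _ <-]; exact: exprn_ge0.
have Dinf : has_inf D by [].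
pose d := inf D.
have dW w : W w -> d <= `|f - w| ^+ 2.
  by move=> Ww; apply: ge_inf => //; exists w.
have [w_ w_P] : {w_ : nat -> H & forall n,
    W (w_ n) /\ `|f - w_ n| ^+ 2 < d + n.+1%:R^-1}.
  apply: (@choice _ _ (fun n w => W w /\ `|f - w| ^+ 2 < d + n.+1%:R^-1)) => n.
  have n0 : 0 < n.+1%:R^-1 :> R by rewrite invr_gt0.
  by have [_ [w Ww <-] ?] := inf_adherent n0 Dinf; exists w.
have cau m n : `|w_ m - w_ n| ^+ 2 <= 2 * (m.+1%:R^-1 + n.+1%:R^-1).
  have [Wm wm] := w_P m; have [Wn wn] := w_P n.
  have /dW : W (2^-1 *: (w_ m - w_ n) + w_ n).
    by apply: Wl => //; apply: subspaceB.
  move=> hd; have -> : `|w_ m - w_ n| ^+ 2 = 2 * `|f - w_ m| ^+ 2 + 2 * `|f - w_ n| ^+ 2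
     - 4 * `|f - (2^-1 *: (w_ m - w_ n) + w_ n)| ^+ 2.
    rewrite -!(dot_norm hdot) !dotE.
    by rewrite (dC (w_ n) (w_ m)) !(dC _ f); field.
  by move: wm wn; set a := _ .+1%:R^-1; set b := _ .+1%:R^-1; lra.
have [q wq] : exists q : H, w_ @ \oo --> q.
  apply: (dot_complete hdot) => e e0.
  (* Beyond [N] the bound [cau] is at most [4 / N.+1], which must fall below [e ^+ 2]. *)
  pose N := Num.truncn (4 / e ^+ 2).
  have Ne : 4 * N.+1%:R^-1 < e ^+ 2.
    rewrite ltr_pdivrMr// mulrC -ltr_pdivrMr ?exprn_gt0//.
    by rewrite truncnS_gt.
  exists N => m n Nm Nn; rewrite -(ltr_pXn2r (n := 2))// ?nnegrE// ?ltW//.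
  apply: le_lt_trans (cau m n) _; apply: le_lt_trans Ne.
  have le1 (k : nat) : (N <= k)%N -> k.+1%:R^-1 <= N.+1%:R^-1 :> R.
    by move=> Nk; rewrite lef_pV2 ?posrE// ler_nat.
  move: (le1 _ Nm) (le1 _ Nn).
  by move: (m.+1%:R^-1) (n.+1%:R^-1) (N.+1%:R^-1) => x y z; lra.
have wqe e : 0 < e -> \forall n \near \oo, `|w_ n - q| < e.
  by move=> e0; move/cvgr_dist_lt : wq => /(_ _ e0); apply: filterS => n; rewrite distrC.
have Wq : W q.
  apply: Wc => e e0; have [N _ NP] := wqe _ e0.
  by exists (w_ N); [exact: (w_P N).1|apply: NP => /=].
have fq : `|f - q| ^+ 2 <= d.
  have : (fun n => `|f - w_ n| ^+ 2) @ \oo --> `|f - q| ^+ 2.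
    rewrite (_ : (fun n => _) = (fun n => `|f - w_ n| * `|f - w_ n|)); last first.
      by apply/funext => n; rewrite expr2.
    by rewrite expr2; apply: cvgM; apply: cvg_norm; apply: cvgB => //; exact: cvg_cst.
  have : (fun n => d + n.+1%:R^-1) @ \oo --> d + 0.
    by apply: cvgD; [exact: cvg_cst|exact: cvg_harmonic].
  rewrite addr0 => c1 c2; apply: (ler_cvg_to c2 c1); near=> n.
  by apply: ltW; exact: (w_P n).2.
exists q => // h Wh.
have [->|h0] := eqVneq h 0; first by rewrite dot0r.
have hh : 0 < dot h h by rewrite lt_def dot_eq0 h0 dot_ge0.
(* The best competitor on the line through [q] in direction [h]; it would gain
   [dot (f - q) h ^+ 2 / dot h h]. *)
have : W (dot (f - q) h / dot h h *: h + q) by exact: Wl.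
move/dW/(le_trans fq); rewrite (addrC _ q) opprD addrA (normB_sq (f - q)).
rewrite -(dot_norm hdot (_ *: h)) !dotZr dotZl.
set x := dot (f - q) h.
rewrite -subr_ge0 (_ : _ - _ = - (x ^+ 2 / dot h h)); last first.
  by field; rewrite gt_eqF.
rewrite oppr_ge0 pmulr_lle0 ?invr_gt0// => x0; apply/eqP; rewrite -sqrf_eq0.
by rewrite eq_le x0 sqr_ge0.
Unshelve. all: by end_near. Qed.

(** The kernel of [phi] is closed. If it is not everything, the part [n] of some vector orthogonal
    to it represents [phi] after rescaling, because each [f] differs from a multiple of [n] by an
    element of the kernel. *)
Lemma riesz (phi : H -> R) M :
  (forall a u v, phi (a *: u + v) = a * phi u + phi v) ->
  (forall u, `|phi u| <= M * `|u|) -> exists g, forall f, dot g f = phi f.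
Proof.
move=> pl pM.
have p0 : phi 0 = 0.
  by have := pl (-1) 0 0; rewrite scaler0 addr0 mulN1r addNr.
have pB u v : phi (u - v) = phi u - phi v.
  by rewrite -scaleN1r addrC pl mulN1r addrC.
have cK : closed_subspace [set u | phi u = 0].
  split => //= [a u v|u uP].
    by rewrite pl => -> ->; rewrite mulr0 addr0.
  apply/eqP; rewrite -normr_eq0 eq_le normr_ge0 andbT; apply: le_eps => e e0.
  rewrite add0r.
  have [|v /= v0 vu] := uP (e / (`|M| + 1)).
    by rewrite divr_gt0// ltr_wpDl.
  rewrite -normrN -[- _]add0r -{1}v0 -pB (le_trans (pM _))//.
  rewrite (le_trans (ler_wpM2r _ (ler_norm M)))//.
  apply: le_trans (_ : (`|M| + 1) * `|v - u| <= _).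
    by rewrite ler_wpM2r// lerDl.
  by rewrite mulrC -ler_pdivlMr ?ltr_wpDl// ltW.
have [[f0 pf0]|/forallNP pall] := pselect (exists f, phi f != 0); last first.
  by exists 0 => f; rewrite dot0l; have /negP/negPn/eqP := pall f.
have [q /= q0 qP] := projection f0 cK.
pose n := f0 - q.
have pn : phi n != 0 by rewrite pB q0 subr0.
have n0 : dot n n != 0.
  rewrite dot_eq0; apply/eqP => n0; move: pn.
  by rewrite n0 p0 eqxx.
exists (phi n / dot n n *: n) => f; rewrite dotZl.
have : dot n (f - phi f / phi n *: n) = 0.
  by apply: qP => /=; rewrite -scaleNr addrC pl; field.
rewrite dotBr dotZr => /eqP; rewrite subr_eq0 => /eqP ->.
by field; rewrite pn n0.
Qed.

Lemma form_operator (b : H -> H -> R) M :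
  (forall a u v w, b (a *: u + v) w = a * b u w + b v w) ->
  (forall a u v w, b w (a *: u + v) = a * b w u + b w v) ->
  (forall u v, `|b u v| <= M * `|u| * `|v|) ->
  exists B, [/\ linear B, forall u, `|B u| <= M * `|u| &
                forall u v, dot (B u) v = b u v].
Proof.
move=> bl br bM.
have [B BP] : {B : H -> H & forall u v, dot (B u) v = b u v}.
  by apply: (@choice _ _ (fun u g => forall v, dot g v = b u v)) => u; exact: riesz.
exists B; split => //.
- move=> a u v; apply: dot_inj => w.
  by rewrite (dotDZl hdot) !BP bl.
- move=> u; have [->|Bu0] := eqVneq (B u) 0.
    (* The sign of [M] is unknown, so the nonnegativity of [M * |u|] is read off the bound at the
       pair [u], [u]. *)
    by rewrite normr0; have := bM u 0; rewrite normr0 mulr0 normr_le0 => /eqP _;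
    have := le_trans (normr_ge0 _) (bM u u); have [->|u0] := eqVneq u 0;
    rewrite ?normr0 ?mulr0// pmulr_lge0// normr_gt0.
  have := bM u (B u); rewrite -BP ger0_norm ?dot_ge0// (dot_norm hdot) expr2.
  by rewrite ler_pM2r// normr_gt0.
Qed.

Lemma exists_adjoint A M : linear A -> (forall u, `|A u| <= M * `|u|) ->
  exists B, [/\ linear B, forall u, `|B u| <= M * `|u| &
                forall u v, dot (A u) v = dot u (B v)].
Proof.
move=> Al AM; have [||u v|B [Bl BM BP]] := form_operator (b := fun u v => dot u (A v)) (M := M).
- by move=> a u v w; rewrite (dotDZl hdot).
- by move=> a u v w; rewrite Al dotDr dotZr.
- rewrite (le_trans (dot_CS _ _))// (le_trans (ler_wpM2l _ (AM v)))//.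
  by rewrite mulrCA mulrA.
by exists B; split => // u v; rewrite (dC u) BP dC.
Qed.

Lemma closed_subspaceI (W1 W2 : set H) :
  closed_subspace W1 -> closed_subspace W2 -> closed_subspace (W1 `&` W2).
Proof.
move=> [z1 l1 c1] [z2 l2 c2]; split => // [a u v [? ?] [? ?]|u uP].
  by split; [exact: l1|exact: l2].
by split; [apply: c1|apply: c2] => e /uP[v [? ?] ?]; exists v.
Qed.

Lemma eps_eq0 u M : (forall e, 0 < e -> `|u| <= M * e) -> u = 0.
Proof.
move=> h; apply/eqP; rewrite -normr_le0; apply: le_eps => e e0; rewrite add0r.
have M1 : 0 < `|M| + 1 by rewrite ltr_wpDl.
apply: le_trans (h (e / (`|M| + 1)) _) _; first by rewrite divr_gt0.
rewrite mulrCA ger_pMr// ler_pdivrMr// mul1r (le_trans (ler_norm _))//.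
by rewrite lerDl.
Qed.

Lemma closed_subspace_ker A M : linear A -> (forall u, `|A u| <= M * `|u|) ->
  closed_subspace [set u | A u = 0].
Proof.
move=> Al AM; split => /= [|a u v Au Av|u uP]; first exact: lin0.
  by rewrite Al Au Av scaler0 addr0.
apply: (@eps_eq0 _ `|M|) => e /uP[v /= Av vu].
rewrite -normrN -(linN Al) -[A (- u)]add0r -Av -(linD Al).
rewrite (le_trans (AM _))// (le_trans (ler_wpM2r _ (ler_norm M)))//.
by rewrite ler_wpM2l// ltW.
Qed.

Lemma closed_subspace_orth (W : set H) :
  closed_subspace [set u | forall w, W w -> dot u w = 0].
Proof.
split => [w _|a u v uW vW w Ww|u uP w Ww]; first by rewrite dot0l.
  by rewrite (dotDZl hdot) uW// vW// mulr0 addr0.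
have : `|dot u w| <= 0.
  apply: le_eps => e e0; rewrite add0r.
  have w1 : 0 < `|w| + 1 by rewrite ltr_wpDl.
  have [|v vW vu] := uP (e / (`|w| + 1)); first by rewrite divr_gt0.
  rewrite -normrN -dotNl -[dot _ _]add0r -(vW w)// -dotDl (le_trans (dot_CS _ _))//.
  apply: le_trans (_ : `|v - u| * (`|w| + 1) <= _).
    by rewrite ler_wpM2l// lerDl.
  by rewrite -ler_pdivlMr// ltW.
by rewrite normr_le0 => /eqP.
Qed.

Definition positive_operator S :=
  [/\ linear S, forall u v, dot (S u) v = dot u (S v) & forall u, 0 <= dot u (S u)].

(** The defect [x = S u - s *: u] satisfies [S x = - s *: x], and positivity of [S] leaves only
    [x = 0]. *)
Lemma positive_opBr S s u : positive_operator S -> 0 < s ->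
  S (S u) = s ^+ 2 *: u -> S u = s *: u.
Proof.
move=> [Sl _ Sp] s0 SSu; pose x := S u - s *: u.
have Sx : S x = - s *: x.
  rewrite (linB Sl) (linZ Sl) SSu scalerBr scalerA expr2.
  by rewrite !scaleNr mulNr scaleNr opprK addrC.
have := Sp x; rewrite Sx dotZr mulNr oppr_ge0 pmulr_rle0// => x0.
apply/eqP; rewrite -subr_eq0 -dot_eq0 eq_le dot_ge0 andbT.
exact: x0.
Qed.

(** Cauchy-Schwarz for the form of [S] at [u] and [S u] bounds [|S u| ^+ 4] by the product of the
    quadratic form at [u] and at [S u]; invariance of [N] makes both factors controllable. *)
Lemma positive_op_norm S (N : set H) s : positive_operator S -> 0 <= s ->
  (forall u, N u -> N (S u)) -> (forall u, N u -> dot u (S u) <= s * `|u| ^+ 2) ->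
  forall u, N u -> `|S u| <= s * `|u|.
Proof.
move=> [Sl Sa Sp] s0 NS Ns u Nu.
have : dot u (S (S u)) ^+ 2 <= dot u (S u) * dot (S u) (S (S u)).
  apply: (@pos_form_CS (fun x y => dot x (S y)) u (S u)) => //.
    by move=> x y; rewrite -Sa dC.
  by move=> a x y z; rewrite (dotDZl hdot).
rewrite -Sa (dot_norm hdot) => h.
have [->|Su0] := eqVneq (`|S u|) 0; first by rewrite mulr_ge0.
have Sp0 : 0 < `|S u| by rewrite lt_def Su0 normr_ge0.
have {}h : (`|S u| ^+ 2) ^+ 2 <= (s * `|u| ^+ 2) * (s * `|S u| ^+ 2).
  by apply: le_trans h _; apply: ler_pM => //; [exact: Ns|apply: Ns; exact: NS].
rewrite -(ler_pXn2r (n := 2))// ?nnegrE ?mulr_ge0//.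
rewrite -(ler_pM2r (x := `|S u| ^+ 2)) ?exprn_gt0//.
by rewrite -expr2 (le_trans h)// le_eqVlt; apply/orP; left; apply/eqP; ring.
Qed.

(** Existence of a cluster point, phrased so that no subsequence has to be extracted. *)
Definition compact_seq A := forall u : nat -> H, (forall n, `|u n| <= 1) ->
  exists w, forall e n, 0 < e -> exists2 m, (n <= m)%N & `|A (u m) - w| < e.

Lemma harmonic_lt e : 0 < e -> exists N : nat, forall n, (N <= n)%N -> n.+1%:R^-1 < e.
Proof.
move=> e0; exists (Num.truncn e^-1) => n Nn.
rewrite invf_plt ?posrE//; apply: lt_le_trans (truncnS_gt _) _.
by rewrite ler_nat.
Qed.

(* A maximizing sequence [u_n] is an approximate eigenvector of [S^2], so its
   limit points are those of [S^2 u_n / s^2], which exist by compactness. *)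
Lemma top_eigenvector S M (N V : set H) s :
  positive_operator S -> (forall u, `|S u| <= M * `|u|) -> compact_seq (S \o S) ->
  (forall u, N u -> N (S u)) -> (forall u, N u -> `|S u| <= s * `|u|) ->
  closed_subspace V -> V `<=` N -> 0 < s ->
  (forall e, 0 < e -> exists u, [/\ V u, `|u| = 1 & s - e < `|S u|]) ->
  exists u, [/\ V u, `|u| = 1 & S u = s *: u].
Proof.
move=> Spos SM Sc NS Ns cV VN s0 sup.
have [Sl Sa Sp] := Spos; have [V0 Vl Vc] := cV.
have [u uP] : {u : nat -> H & forall n,
    [/\ V (u n), `|u n| = 1 & s - n.+1%:R^-1 < `|S (u n)|]}.
  apply: (@choice _ _ (fun n u => [/\ V u, `|u| = 1 & s - n.+1%:R^-1 < `|S u|])).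
  by move=> n; apply: sup; rewrite invr_gt0.
have uV n : V (u n) by case: (uP n).
have u1 n : `|u n| = 1 by case: (uP n).
have us n : s - n.+1%:R^-1 < `|S (u n)| by case: (uP n).
have [|w wP] := Sc u; first by move=> n; rewrite u1.
have approx n : `|S (S (u n)) - s ^+ 2 *: u n| ^+ 2 <= 2 * s ^+ 3 * n.+1%:R^-1.
  have := Ns _ (VN _ (uV n)); rewrite u1 mulr1 => h1.
  (* [S (u n)] may leave [V]; it is the invariance of the larger set [N] that bounds
     [S (S (u n))]. *)
  have := Ns _ (NS _ (VN _ (uV n))) => h2.
  rewrite normB_sq dotZr Sa (dot_norm hdot) normrZ u1 mulr1 normrX gtr0_norm//.
  have h3 : `|S (S (u n))| ^+ 2 <= s ^+ 2 * `|S (u n)| ^+ 2.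
    by rewrite -exprMn ler_pXn2r ?nnegrE// mulr_ge0// ltW.
  have h4 := us n; have h0 := normr_ge0 (S (u n)).
  move: h1 h3 h4 h0; move: (`|S (u n)|) (`|S (S (u n))|) (n.+1%:R^-1) => x y z.
  move=> xs yx sz x0.
  have sxz : s - x <= z by lra.
  have : s ^+ 2 * (s ^+ 2 - x ^+ 2) <= s ^+ 2 * (2 * s * z).
    rewrite ler_wpM2l ?exprn_ge0 1?(ltW s0)//.
    rewrite (_ : s ^+ 2 - x ^+ 2 = (s + x) * (s - x)); last by ring.
    by apply: ler_pM; lra.
  by move: yx; lra.
have ss0 : 0 < s ^+ 2 by rewrite exprn_gt0.
pose w0 := (s ^+ 2)^-1 *: w.
have close e : 0 < e ->
    exists n, `|u n - w0| < e /\ `|S (S (u n)) - s ^+ 2 *: u n| < e.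
  (* Two errors of size [d] are added and divided by [s ^+ 2], and the total must stay below [e]. *)
  move=> e0; pose d := Num.min e (e * s ^+ 2 / 2).
  have d0 : 0 < d by rewrite lt_min e0 !mulr_gt0.
  have s4 : 0 < 2 * s ^+ 3 by rewrite mulr_gt0// exprn_gt0.
  have [|k kP] := @harmonic_lt (d ^+ 2 / (2 * s ^+ 3)).
    by rewrite divr_gt0// exprn_gt0.
  have [n /kP kn wn] := wP d k d0.
  have dn : `|S (S (u n)) - s ^+ 2 *: u n| < d.
    rewrite -(ltr_pXn2r (n := 2))// ?nnegrE ?normr_ge0 ?(ltW d0)//.
    by apply: le_lt_trans (approx n) _; rewrite mulrC -ltr_pdivlMr.
  exists n; split; last by apply: lt_le_trans dn _; rewrite ge_min lexx.
  have -> : u n - w0 = (s ^+ 2)^-1 *: (s ^+ 2 *: u n - w).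
    by rewrite scalerBr scalerA mulVf ?scale1r// gt_eqF.
  rewrite normrZ normfV gtr0_norm// mulrC ltr_pdivrMr//.
  rewrite -(subrKA (S (S (u n)))) (le_lt_trans (ler_normD _ _))//.
  rewrite -normrN opprB.
  have d2 : d <= e * s ^+ 2 / 2 by rewrite ge_min lexx orbT.
  by move: dn wn; rewrite /=; lra.
exists w0; split.
- by apply: Vc => e /close[n [? _]]; exists (u n).
- apply/eqP; rewrite -subr_eq0 -normr_le0; apply: le_eps => e /close[n [h _]].
  by rewrite add0r -(u1 n) (le_trans (ler_dist_dist _ _))// distrC ltW.
- apply: positive_opBr => //; apply/eqP; rewrite -subr_eq0; apply/eqP.
  apply: (@eps_eq0 _ (`|M| * `|M| + 1 + s ^+ 2)) => e /close[n [h1 h2]].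
  have -> : S (S w0) - s ^+ 2 *: w0 = S (S (w0 - u n))
      + (S (S (u n)) - s ^+ 2 *: u n) + s ^+ 2 *: (u n - w0).
    by rewrite (linB Sl) (linB Sl) scalerBr !subrKA.
  have SM' v : `|S v| <= `|M| * `|v|.
    by rewrite (le_trans (SM v))// ler_wpM2r// ler_norm.
  rewrite (le_trans (ler_normD _ _))// [leRHS]mulrDl lerD//.
    rewrite (le_trans (ler_normD _ _))// [leRHS]mulrDl mul1r lerD ?(ltW h2)//.
    rewrite (le_trans (SM' _))// -mulrA ler_wpM2l// (le_trans (SM' _))//.
    by rewrite ler_wpM2l// distrC ltW.
  by rewrite normrZ gtr0_norm// ler_wpM2l ?ltW.
Qed.

(** * Square roots by iteration *)

Section SquareRoot.
Variable A : H -> H.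
Hypotheses (Al : linear A) (Aa : forall u v, dot (A u) v = dot u (A v)).
Hypothesis A1 : forall u, `|u - A u| <= `|u|.

Let B u := u - A u.

(* The iterates are polynomials in [B] with nonnegative coefficients, so they are
   controlled by the same iteration on the real number [1], which bounds [B]. *)
Fixpoint sqrt_iter n : H -> H :=
  if n is n'.+1 then fun u => 2^-1 *: (B u + sqrt_iter n' (sqrt_iter n' u))
  else fun=> 0.
Fixpoint sqrt_rate n : R :=
  if n is n'.+1 then 2^-1 * (1 + sqrt_rate n' ^+ 2) else 0.
Local Notation Y := sqrt_iter.
Local Notation y := sqrt_rate.

Let Bl : linear B.
Proof. by move=> a u v; rewrite /B Al scalerBr opprD addrACA. Qed.

Let YE n u : Y n.+1 u = 2^-1 *: (B u + Y n (Y n u)).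
Proof. by []. Qed.

Let yE n : y n.+1 = 2^-1 * (1 + y n ^+ 2).
Proof. by []. Qed.

Let Yl n : linear (Y n).
Proof.
elim: n => [|n IH] a u v /=; first by rewrite scaler0 addr0.
by rewrite Bl !IH addrACA -(scalerDr a) (scalerDr 2^-1) !scalerA (mulrC a).
Qed.

Let Ya n u v : dot (Y n u) v = dot u (Y n v).
Proof.
elim: n u v => [|n IH] u v /=; first by rewrite dot0l dot0r.
by rewrite dotZl dotZr dotDl dotDr !IH dotBl dotBr Aa.
Qed.

Let Ycomm C n : linear C -> (forall u, C (B u) = B (C u)) ->
  forall u, C (Y n u) = Y n (C u).
Proof.
move=> Cl CB; elim: n => [|n IH] u /=; first by rewrite (lin0 Cl).
by rewrite (linZ Cl) (linD Cl) CB !IH.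
Qed.

Let YY m n u : Y m (Y n u) = Y n (Y m u).
Proof. by apply: Ycomm => // v; rewrite (Ycomm (C := B)). Qed.

Let y_ge0 n : 0 <= y n.
Proof.
by case: n => [|n] //=; rewrite mulr_ge0// addr_ge0// sqr_ge0.
Qed.

Let y_le1 n : y n <= 1.
Proof.
elim: n => [|n IH] //=.
have : y n ^+ 2 <= 1 by rewrite exprn_ile1.
lra.
Qed.

Let Yy n u : `|Y n u| <= y n * `|u|.
Proof.
elim: n u => [|n IH] u /=; first by rewrite normr0 mul0r.
rewrite normrZ gtr0_norm// -mulrA ler_wpM2l//.
rewrite (le_trans (ler_normD _ _))// mulrDl mul1r lerD//; first exact: A1.
by rewrite (le_trans (IH _))// expr2 -mulrA ler_wpM2l.
Qed.

(** Since the iterates commute, a difference of squares factors, for the operators and for the rates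
    alike; the two recursions then match term by term. *)
Let YS n u : `|Y n.+1 u - Y n u| <= (y n.+1 - y n) * `|u|.
Proof.
elim: n u => [|n IH] u.
  by rewrite !subr0; exact: (Yy 1).
have -> : Y n.+2 u - Y n.+1 u = 2^-1 *: (Y n.+1 (Y n.+1 u - Y n u)
                                  + Y n (Y n.+1 u - Y n u)).
  rewrite (YE n.+1 u) [X in _ - X](YE n u) -scalerBr; congr (_ *: _).
  rewrite !(linB (Yl _)) (YY n.+1 n) subrKA [B u + _]addrC.
  by rewrite opprD addrA addrK.
have -> : y n.+2 - y n.+1 = 2^-1 * (y n.+1 + y n) * (y n.+1 - y n).
  by rewrite (yE n.+1) [X in _ - X = _](yE n); field.
rewrite normrZ gtr0_norm// -!mulrA ler_wpM2l// mulrDl.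
rewrite (le_trans (ler_normD _ _))// lerD//;
  by rewrite (le_trans (Yy _ _))// ler_wpM2l.
Qed.

Let y_nd : nondecreasing_seq y.
Proof.
apply/nondecreasing_seqP; elim=> [|n IH]; first exact: y_ge0.
rewrite (yE n.+1) [leLHS](yE n) ler_wpM2l// lerD2l.
by rewrite ler_pXn2r// nnegrE.
Qed.

Let Ymn m n u : (n <= m)%N -> `|Y m u - Y n u| <= (y m - y n) * `|u|.
Proof.
elim: m => [|m IH].
  by rewrite leqn0 => /eqP ->; rewrite !subrr normr0 mul0r.
rewrite leq_eqVlt => /predU1P[->|]; first by rewrite !subrr normr0 mul0r.
rewrite ltnS => /IH h.
rewrite -(subrKA (Y m u)) (le_trans (ler_normD _ _))//.
rewrite -[y m.+1](subrK (y m)) -addrA mulrDl lerD//.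
Qed.

Let Ycvg u : exists l : H, Y ^~ u @ \oo --> l.
Proof.
have yc : cvgn y.
  apply: nondecreasing_is_cvgn; first exact: y_nd.
  by exists 1 => _ [n _ <-].
apply: (dot_complete hdot) => e e0.
have u1 : 0 < `|u| + 1 by rewrite ltr_wpDl.
have [N _ NP] : \forall n \near \oo, `|limn y - y n| < e / 2 / (`|u| + 1).
  by move/cvgr_dist_lt : yc; apply; rewrite !divr_gt0.
have YN n : (N <= n)%N -> `|Y n u - Y N u| < e / 2.
  move=> Nn; apply: le_lt_trans (Ymn _ Nn) _.
  have h : y n - y N < e / 2 / (`|u| + 1).
    apply: le_lt_trans (NP N (leqnn _)).
    rewrite (le_trans _ (ler_norm _))// lerB//.
    by apply: nondecreasing_cvgn_le; [exact: y_nd|].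
  apply: le_lt_trans (_ : (y n - y N) * (`|u| + 1) < _); last by rewrite -ltr_pdivlMr.
  by rewrite ler_wpM2l ?lerDl// subr_ge0 y_nd.
exists N => m n /YN hm /YN hn.
rewrite -(subrKA (Y N u)) (le_lt_trans (ler_normD _ _))// [ltRHS]splitr.
by rewrite ltrD// distrC.
Qed.

(** The limit [Z] solves [2 Z = B + Z^2], so [(I - Z)^2 = I - B = A]. As [Z] is a contraction,
    [I - Z] is positive and bounded by 2. *)
Lemma exists_sqrt : exists S,
  [/\ positive_operator S, forall u, `|S u| <= 2 * `|u| &
      forall u, S (S u) = A u].
Proof.
have [Z ZP] : {Z : H -> H & forall u, Y ^~ u @ \oo --> Z u} by exact: choice Ycvg.
have Zu (f : nat -> H) u : f @ \oo --> u -> (forall l, f @ \oo --> l -> l = u).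
  by move=> fu l fl; exact: (cvg_unique _ fl fu).
have Zl : linear Z.
  move=> a u v; apply: Zu (ZP _).
  have -> : Y ^~ (a *: u + v) = (fun n => a *: Y n u + Y n v).
    by apply/funext => n; rewrite Yl.
  by apply: cvgD; [exact: cvgZl_tmp|].
have Za u v : dot (Z u) v = dot u (Z v).
  have := @cvg_dotl _ _ v (ZP u); rewrite (_ : (fun n => _) = (fun n => dot (Y n v) u)).
    by move/(cvg_unique _ (@cvg_dotl _ _ u (ZP v))) => <- //; rewrite dC.
  by apply/funext => n; rewrite Ya dC.
have Z1 u : `|Z u| <= `|u|.
  apply: (ler_cvg_to (cvg_norm (ZP u)) (@cvg_cst _ `|u| _ _ _)).
  near=> n; rewrite (le_trans (Yy _ _))// ler_piMl//.
have ZE u : Z u = 2^-1 *: (B u + Z (Z u)).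
  have := ZP u; rewrite -cvg_shiftS; apply: Zu.
  apply: cvgZl_tmp; apply: cvgD; first exact: cvg_cst.
  (* Convergence is only pointwise, so the moving argument is handled by the uniform bound of the
     iterates by 1. *)
  have -> : (fun n => Y n (Y n u)) = (fun n => Y n (Y n u - Z u) + Y n (Z u)).
    by apply/funext => n; rewrite (linB (Yl n)) subrK.
  rewrite -[Z (Z u)]add0r; apply: cvgD; last exact: ZP.
  apply: (@cvg_normB_le _ (fun n => `|Y n u - Z u|) 0) => [n|].
    by rewrite subr0 (le_trans (Yy _ _))// ler_piMl.
  rewrite -[0](@normr0 _ H); apply: cvg_norm; rewrite -(subrr (Z u)).
  by apply: cvgB; [exact: ZP|exact: cvg_cst].
exists (fun u => u - Z u); split.
- split=> [a u v|u v|u].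
  + by rewrite Zl scalerBr opprD addrACA.
  + by rewrite dotBl dotBr Za.
  + rewrite dotBr subr_ge0 (dot_norm hdot) (le_trans (ler_norm _))//.
    by rewrite (le_trans (dot_CS _ _))// expr2 ler_wpM2l.
- by move=> u; rewrite (le_trans (ler_normB _ _))// mulr_natl mulr2n lerD2l.
- move=> u; rewrite (linB Zl) opprB.
  have ZZ : Z (Z u) = 2 *: Z u - B u.
    by rewrite [in RHS]ZE scalerA divff// scale1r addrAC subrr add0r.
  by rewrite ZZ scaler_nat mulr2n (addrAC (_ + _)) addrK subrKA subKr.
Unshelve. all: by end_near. Qed.
End SquareRoot.

End Hilbert.

(** * The Hilbert space L^2(pi) *)

Section L2Hilbert.
Context d (T : measurableType d) (R : realType) (pi : probability T R).
Implicit Types (f g h u v w : L2 pi) (F G : T -> R).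

Lemma L2_measurable f : measurable_fun [set: T] f.
Proof. by have /andP[/set_mem] := Lspace_Lfun f. Qed.

Lemma L2_integrable_mul f g : pi.-integrable [set: T] (EFin \o (fun x => f x * g x)).
Proof.
by apply/Lfun1_integrable; exact: Lfun2_mul_Lfun1 (Lspace_Lfun f) (Lspace_Lfun g).
Qed.

Lemma EFin_dotp f g : (dotp f g)%:E = (\int[pi]_x (f x * g x)%:E)%E.
Proof.
rewrite /dotp /Rintegral fineK//.
exact: (integrable_fin_num measurableT (L2_integrable_mul f g)).
Qed.

Lemma dotp_ae f g F : measurable_fun [set: T] F -> (f : T -> R) = F %[ae pi] ->
  (dotp f g)%:E = (\int[pi]_x (F x * g x)%:E)%E.
Proof.
move=> mF fF; rewrite EFin_dotp; apply: ae_eq_integral => //.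
- by apply/measurable_EFinP; apply: measurable_funM; exact: L2_measurable.
- by apply/measurable_EFinP; apply: measurable_funM => //; exact: L2_measurable.
- by apply: filterS fF => x + xT => /(_ xT) ->.
Qed.

Let poweR_abs2 (r : R) : (`|r%:E| `^ 2)%E = (r ^+ 2)%:E.
Proof. by rewrite /= (powR_mulrn 2)// -normrX ger0_norm ?sqr_ge0. Qed.

Lemma dotp_norm f : dotp f f = `|f| ^+ 2.
Proof.
apply: EFin_inj; rewrite EFin_dotp LspaceNormE.
have N0 : (0 <= 'N[pi]_2[EFin \o f])%E := Lnorm_ge0 _ _ _.
have {1}-> : (fine 'N[pi]_2[EFin \o f] ^+ 2)%:E = ('N[pi]_2[EFin \o f] `^ 2)%E.
  have Nf : 'N[pi]_2[EFin \o f]%E \is a fin_num.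
    by rewrite ge0_fin_numE//; have /andP[_ /set_mem] := Lspace_Lfun f.
  by rewrite -{2}(fineK Nf) /= (powR_mulrn 2)// fine_ge0.
rewrite poweR_Lnorm//.
by apply: eq_integral => x _; rewrite -expr2 poweR_abs2.
Qed.

Lemma exists_L2 F : measurable_fun [set: T] F ->
  (\int[pi]_x (F x ^+ 2)%:E < +oo)%E -> exists f : L2 pi, (f : T -> R) = F %[ae pi].
Proof.
move=> mF F2.
suff FL : F \in Lfun pi 2%:E.
  exists (Lspace_class (Lfun_Sub (lee1n 2) FL)); exact: Lspace_classE.
rewrite inE; apply/andP; split; rewrite inE//=.
rewrite /finite_norm unlock poweR_lty//.
by under eq_integral => x _ do rewrite poweR_abs2.
Qed.

Lemma dotp_DZl a u v w : dotp (a *: u + v) w = a * dotp u w + dotp v w.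
Proof.
apply: EFin_inj.
rewrite (@dotp_ae _ _ (fun x => a * u x + v x)); last 2 first.
- by apply: measurable_funD; [apply: measurable_funM|] => //; exact: L2_measurable.
- apply: filterS2 (LspaceDE (a *: u) v) (LspaceZE a u) => x + + xT.
  by move=> /(_ xT) -> /(_ xT) ->.
under eq_integral => x _ do rewrite mulrDl -mulrA EFinD EFinM.
rewrite integralD//.
- by rewrite (integralZl measurableT (L2_integrable_mul u w)) -!EFin_dotp.
- by apply: integrableZl => //; exact: L2_integrable_mul.
- exact: L2_integrable_mul.
Qed.

Lemma normL2_ae f F : measurable_fun [set: T] F -> (f : T -> R) = F %[ae pi] ->
  (`|f| ^+ 2)%:E = (\int[pi]_x (F x ^+ 2)%:E)%E.
Proof.
move=> mF fF; rewrite -dotp_norm EFin_dotp; apply: ae_eq_integral => //.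
- by apply/measurable_EFinP; apply: measurable_funM; exact: L2_measurable.
- by apply/measurable_EFinP; apply: measurable_funX.
- by apply: filterS fF => x + xT => /(_ xT) ->; rewrite expr2.
Qed.

Lemma normL2E f : (`|f| ^+ 2)%:E = (\int[pi]_x (f x ^+ 2)%:E)%E.
Proof. by apply: normL2_ae; [exact: L2_measurable|exact: ae_eq_refl]. Qed.

(** Integrate [|F| <= c / 2 + F^2 / (2 c)] against the probability measure: each term contributes at
    most [c / 2]. *)
Lemma L1_le_L2 F (c : R) : 0 < c -> measurable_fun [set: T] F ->
  (\int[pi]_x (F x ^+ 2)%:E <= (c ^+ 2)%:E)%E -> (\int[pi]_x `|F x|%:E <= c%:E)%E.
Proof.
move=> c0 mF F2.
have c20 : 0 <= (2 * c)^-1 by rewrite invr_ge0 mulr_ge0// ltW.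
have mF2 : measurable_fun [set: T] (fun x => (F x ^+ 2)%:E).
  by apply/measurable_EFinP; exact: measurable_funX.
apply: (@le_trans _ _ (\int[pi]_x ((c / 2)%:E + (2 * c)^-1%:E * (F x ^+ 2)%:E))%E).
  apply: ge0_le_integral => //.
  - by apply/measurable_EFinP; exact: measurableT_comp.
  - by apply: emeasurable_funD => //; exact: measurable_funeM.
  - move=> x _; rewrite -EFinM -EFinD lee_fin.
    have : 0 <= (2 * c)^-1 * (`|F x| - c) ^+ 2 by rewrite mulr_ge0// sqr_ge0.
    rewrite sqrrB real_normK ?num_real//.
    rewrite (_ : (2 * c)^-1 * _ = c / 2 + (2 * c)^-1 * F x ^+ 2 - `|F x|) ?subr_ge0//.
    by field; rewrite gt_eqF.
rewrite ge0_integralD//; last 3 first.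
- by move=> x _; rewrite lee_fin divr_ge0// ltW.
- by move=> x _; rewrite -EFinM lee_fin mulr_ge0// sqr_ge0.
- exact: measurable_funeM.
rewrite integral_cst// [X in (_ * X + _)%E](probability_setT pi) mule1 ge0_integralZl//; last first.
  by move=> x _; rewrite lee_fin sqr_ge0.
apply: (@le_trans _ _ ((c / 2)%:E + (2 * c)^-1%:E * (c ^+ 2)%:E)%E).
  by rewrite leeD2l// lee_wpmul2l.
by rewrite -EFinM -EFinD lee_fin le_eqVlt; apply/orP; left; apply/eqP; field; rewrite gt_eqF.
Qed.

Let limn_einf_le (a : nat -> \bar R) c :
  (\forall n \near \oo, (a n <= c)%E) -> (limn_einf a <= c)%E.
Proof.
move=> [N _ NP]; rewrite limn_einf_lim.
have -> : limn (einfs a) = ereal_sup (range (einfs a)).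
  by apply: cvg_lim => //; exact: cvg_einfs_sup.
apply: ge_ereal_sup => _ [n _ <-].
apply: (@le_trans _ _ (a (maxn n N))); last by apply: NP; rewrite /= leq_maxr.
by apply: ereal_inf_lbound; exists (maxn n N) => //=; rewrite leq_maxl.
Qed.

(** The increments have summable L^1 norms, so the sum of their absolute values is integrable, hence
    finite almost everywhere, and the telescoping series converges absolutely there. *)
Lemma fast_cauchy_cvg (g : nat -> L2 pi) :
  (forall n, `|g n.+1 - g n| <= (2 ^ n.+1)%:R^-1) ->
  {ae pi, forall x, cvgn (fun n => g n x)}.
Proof.
move=> gS.
pose h n x := `|g n.+1 x - g n x|.
have h0 n x : (0 <= (h n x)%:E)%E by rewrite lee_fin /h normr_ge0.
have mh n : measurable_fun [set: T] (fun x => (h n x)%:E).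
  apply/measurable_EFinP; apply: measurableT_comp => //.
  by apply: measurable_funB; exact: L2_measurable.
have hS n : (\int[pi]_x (h n x)%:E <= (1 / (2 ^ n.+1)%:R)%:E)%E.
  rewrite div1r; apply: L1_le_L2; first by rewrite invr_gt0 ltr0n expn_gt0.
    by apply: measurable_funB; exact: L2_measurable.
  rewrite -(@normL2_ae (g n.+1 - g n)); last 2 first.
  - by apply: measurable_funB; exact: L2_measurable.
  - apply: filterS2 (LspaceDE (g n.+1) (- g n)) (LspaceNE (g n)) => x + + xT.
    by move=> /(_ xT) -> /(_ xT) ->.
  by rewrite lee_fin ler_pXn2r// nnegrE.
have sumh : (\int[pi]_x (\sum_(n <oo) (h n x)%:E) <= 1%:E)%E.
  rewrite integral_nneseries//.
  apply: le_trans (@epsilon_trick0 R 1 xpredT ler01).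
  apply: lee_nneseries => [n _ _|n _]; last exact: hS.
  exact: integral_ge0.
have ih : pi.-integrable [set: T] (fun x => \sum_(n <oo) (h n x)%:E)%E.
  apply/integrableP; split.
    by apply: ge0_emeasurable_sum => [n x _ _|n _]; [exact: h0|exact: mh].
  under eq_integral => x _.
    rewrite gee0_abs; last by apply: nneseries_ge0.
    over.
  by apply: le_lt_trans sumh _; rewrite ltry.
apply: filterS (integrable_ae measurableT ih) => x /(_ I) fx.
have : cvgn (series (fun n => h n x)).
  apply: nnseries_is_cvg => [n|]; first by rewrite /h normr_ge0.
  by rewrite -ge0_fin_numE//; apply: nneseries_ge0.
move/normed_cvg => cs.
rewrite (_ : (fun n => g n x) = (fun n => g 0%N x + series (telescope (fun n => g n x)) n)).
  by apply: is_cvgD; [exact: is_cvg_cst|exact: cs].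
by apply/funext => n; exact: eq_sum_telescope.
Qed.

(** Riesz-Fischer: a fast subsequence converges almost everywhere to [F], and Fatou's lemma bounds
    the L^2 distance from [F] to [u n]. *)
Lemma L2_complete (u : nat -> L2 pi) :
  (forall e : R, 0 < e -> exists N : nat, forall m n, (N <= m)%N -> (N <= n)%N ->
    `|u m - u n| < e) ->
  exists l : L2 pi, u @ \oo --> l.
Proof.
move=> cu.
have [K KP] : {K : nat -> nat & forall i m n, (K i <= m)%N -> (K i <= n)%N ->
    `|u m - u n| < (2 ^ i.+1)%:R^-1}.
  apply: (@choice _ _ (fun i N => forall m n, (N <= m)%N -> (N <= n)%N ->
    `|u m - u n| < (2 ^ i.+1)%:R^-1)) => i.
  by apply: cu; rewrite invr_gt0 ltr0n expn_gt0.
(* The sum makes [k] nondecreasing and at least [K]; the summand [n] makes it tend to infinity. *)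
pose k n := (\sum_(i < n.+1) K i + n)%N.
have Kk n : (K n <= k n)%N by rewrite /k big_ord_recr/= -addnA addnCA leq_addr.
have kS n : (k n <= k n.+1)%N by rewrite /k [in leqRHS]big_ord_recr/= leq_add ?leq_addr.
pose g n := u (k n).
have gS n : `|g n.+1 - g n| <= (2 ^ n.+1)%:R^-1.
  by apply: ltW; apply: KP => //; exact: leq_trans (Kk n) (kS n).
(* The upper limit is measurable everywhere and agrees with the limit wherever that exists. *)
pose F x := fine (limn_esup (fun n => (g n x)%:E)).
have mF : measurable_fun [set: T] F.
  apply: (measurableT_comp (fine_measurable _)) => //.
  apply: measurable_fun_limn_esup => n; apply/measurable_EFinP; exact: L2_measurable.
have gF : {ae pi, forall x, (fun n => g n x) @ \oo --> F x}.
  apply: filterS (fast_cauchy_cvg gS) => x /cvg_ex[l gl].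
  have -> : F x = l; last exact: gl.
  have : (fun n => (g n x)%:E) @ \oo --> l%:E by apply: cvg_EFin => //; near=> n.
  by rewrite /F; move/cvg_limn_einf_sup => ->.
have dF e n : (\forall m \near \oo, `|g m - u n| <= e) -> 0 <= e ->
    (\int[pi]_x ((F x - u n x) ^+ 2)%:E <= (e ^+ 2)%:E)%E.
  move=> ge e0.
  pose f m x := ((g m x - u n x) ^+ 2)%:E.
  have mf m : measurable_fun [set: T] (f m).
    apply/measurable_EFinP; apply: measurable_funX.
    by apply: measurable_funB; exact: L2_measurable.
  have -> : (\int[pi]_x ((F x - u n x) ^+ 2)%:E
             = \int[pi]_x limn_einf (fun m => f m x))%E.
    apply: ae_eq_integral => //.
    - apply/measurable_EFinP; apply: measurable_funX.
      by apply: measurable_funB => //; exact: L2_measurable.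
    - rewrite (_ : (fun x => _) = (fun x => - limn_esup (fun m => - f m x))%E).
        apply: measurableT_comp => //; apply: measurable_fun_limn_esup => m.
        exact: measurableT_comp.
      apply/funext => x; rewrite -limn_einfN; congr limn_einf.
      by apply/funext => m; exact: (esym (oppeK _)).
    - apply: filterS gF => x gx _.
      have : (fun m => f m x) @ \oo --> ((F x - u n x) ^+ 2)%:E.
        apply: cvg_EFin; first by near=> m.
        rewrite (_ : _ \o _ = (fun m => (g m x - u n x) * (g m x - u n x))).
          by rewrite expr2; apply: cvgM; apply: cvgB => //; exact: cvg_cst.
        by apply/funext => m; rewrite /= expr2.
      by move/cvg_limn_einf_sup => ->.
  apply: le_trans (fatou _ _ _ _) _ => //.
    by move=> m x _; rewrite lee_fin sqr_ge0.
  apply: limn_einf_le; apply: filterS ge => m gm.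
  rewrite -(@normL2_ae (g m - u n)); last 2 first.
  - by apply: measurable_funB; exact: L2_measurable.
  - apply: filterS2 (LspaceDE (g m) (- u n)) (LspaceNE (u n)) => x + + xT.
    by move=> /(_ xT) -> /(_ xT) ->.
  by rewrite lee_fin ler_pXn2r// nnegrE.
have gu e : 0 < e -> exists N, forall n, (N <= n)%N ->
    \forall m \near \oo, `|g m - u n| <= e.
  move=> e0; have [N NP] := cu _ e0; exists N => n Nn.
  exists N => // m /= Nm; apply/ltW/NP => //.
  by apply: leq_trans Nm _; rewrite /k leq_addl.
have mFu n : measurable_fun [set: T] (fun x => F x - u n x).
  by apply: measurable_funB => //; exact: L2_measurable.
(* Only differences [F - u n] are known to be square integrable, so [F] is recovered as the class of
   [F - u N1] plus [u N1]. *)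
have [N1 N1P] := gu _ ltr01.
have [w wF] : exists w : L2 pi, (w : T -> R) = (fun x => F x - u N1 x) %[ae pi].
  apply: exists_L2 => //; apply: le_lt_trans (dF 1 _ (N1P _ (leqnn _)) ler01) _.
  by rewrite ltry.
have lF : ((w + u N1 : L2 pi) : T -> R) = F %[ae pi].
  apply: filterS2 (LspaceDE w (u N1)) wF => x + + xT.
  by move=> /(_ xT) -> /(_ xT) ->; rewrite subrK.
exists (w + u N1); apply/cvgrPdist_le => e e0.
have [N NP] := gu _ e0; exists N => // n /= /NP gn.
rewrite -(ler_pXn2r (n := 2)) ?nnegrE ?normr_ge0 ?(ltW e0)// -lee_fin.
rewrite (@normL2_ae _ (fun x => F x - u n x))//; first exact: dF (ltW e0).
apply: filterS3 lF (LspaceDE (w + u N1) (- u n)) (LspaceNE (u n)) => x + + + xT.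
by move=> /(_ xT) <- /(_ xT) -> /(_ xT) ->.
Unshelve. all: by end_near. Qed.

Lemma hilbert_L2 : hilbert_dot (@dotp d T R pi).
Proof.
split; [|exact: dotp_DZl|exact: dotp_norm|exact: L2_complete].
by move=> u v; apply: eq_Rintegral => x _; rewrite mulrC.
Qed.

End L2Hilbert.

(** * Measure-preserving maps and Markov kernels *)

Section MeasurePreserving.
Context d (T : measurableType d) (R : realType) (mu : {measure set T -> \bar R}).

Definition measure_preserving (phi : T -> T) :=
  measurable_fun [set: T] phi /\
  forall A, measurable A -> mu (phi @^-1` A) = mu A.

(** Invariance is given for images, while change of variables needs preimages; the right inverse
    [psi] makes [phi] surjective, so [phi] maps the preimage of [A] onto [A]. *)
Lemma image_preserving (phi psi : T -> T) : measurable_fun [set: T] phi ->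
  cancel psi phi -> (forall A, measurable A -> mu [set phi x | x in A] = mu A) ->
  measure_preserving phi.
Proof.
move=> mphi phiK im; split=> // A mA.
rewrite -[in RHS](_ : phi @` (phi @^-1` A) = A); last first.
  by apply: image_preimage; apply/seteqP; split=> // x _; exists (psi x).
by rewrite im//; rewrite -[_ @^-1` _]setTI; exact: mphi.
Qed.

Context (phi : T -> T) (mp : measure_preserving phi).

Lemma ge0_integral_preserving (f : T -> \bar R) : measurable_fun [set: T] f ->
  (forall x, 0 <= f x)%E -> (\int[mu]_x f (phi x) = \int[mu]_x f x)%E.
Proof.
move=> mf f0; have [mphi im] := mp.
transitivity (\int[pushforward mu phi]_x f x)%E.
  by rewrite ge0_integral_pushforward.
by apply: eq_measure_integral; move=> A mA _; exact: im.
Qed.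

Lemma integral_preserving (f : T -> \bar R) : measurable_fun [set: T] f ->
  (\int[mu]_x f (phi x) = \int[mu]_x f x)%E.
Proof.
move=> mf; rewrite -[fun x => f (phi x)]/(f \o phi) integralE [RHS]integralE.
rewrite funepos_comp funeneg_comp; congr (_ - _)%E.
  exact: (ge0_integral_preserving (measurable_funepos mf) (funepos_ge0 f)).
exact: (ge0_integral_preserving (measurable_funeneg mf) (funeneg_ge0 f)).
Qed.

Lemma ae_preserving (P : T -> Prop) :
  {ae mu, forall x, P x} -> {ae mu, forall x, P (phi x)}.
Proof.
have [mphi im] := mp; move=> [N [mN N0 PN]].
exists (phi @^-1` N); split; last by move=> x /= /PN.
  by rewrite -[_ @^-1` _]setTI; exact: mphi.
by rewrite im.
Qed.
End MeasurePreserving.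

Section L2class.
Context d (T : measurableType d) (R : realType) (pi : probability T R).
Implicit Types (f g h : L2 pi) (F : T -> R).

Lemma L2classE F f : (f : T -> R) = F %[ae pi] -> L2class pi F = f.
Proof.
move=> fF.
have : [set f : L2 pi | (f : T -> R) = F %[ae pi]] (L2class pi F).
  by apply: xgetPex; exists f.
move=> cF; apply: LspaceP; apply: filterS2 fF cF => x + + xT.
by move=> /(_ xT) -> /(_ xT) ->.
Qed.

Lemma L2classP F : (exists f : L2 pi, (f : T -> R) = F %[ae pi]) ->
  (L2class pi F : T -> R) = F %[ae pi].
Proof. by move=> [f fF]; rewrite (L2classE fF). Qed.

End L2class.

Section One.
Context d (T : measurableType d) (R : realType) (pi : probability T R).

Lemma L2oneE : (L2class pi (fun=> 1) : T -> R) = (fun=> 1) %[ae pi].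
Proof.
apply: L2classP; apply: exists_L2 => //.
under eq_integral => x _ do rewrite expr1n.
by rewrite integral_cst// mul1e [ltLHS](probability_setT pi) ltry.
Qed.

Lemma normL2one : `|L2class pi (fun=> 1)| = 1.
Proof.
apply/eqP; rewrite -sqrp_eq1//; apply/eqP/EFin_inj.
rewrite (normL2_ae _ L2oneE)//.
under eq_integral => x _ do rewrite expr1n.
by rewrite integral_cst// mul1e [LHS](probability_setT pi).
Qed.
End One.

(** With [m] the mean of [F], integrate the tangent inequality [2 m F - m^2 <= F^2]; its left side
    has integral [m^2]. *)
Lemma jensen_sqr d (T : measurableType d) (R : realType)
    (mu : {measure set T -> \bar R}) (F : T -> R) :
  mu [set: T] = 1%E -> measurable_fun [set: T] F ->
  (((\int[mu]_x F x)%R ^+ 2)%:E <= \int[mu]_x (F x ^+ 2)%:E)%E.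
Proof.
move=> mu1 mF.
have mF2 : measurable_fun [set: T] (fun x => (F x ^+ 2)%:E).
  by apply/measurable_EFinP; exact: measurable_funX.
have [->|F2y] := eqVneq (\int[mu]_x (F x ^+ 2)%:E)%E +oo%E; first exact: leey.
have icst (c : R) : mu.-integrable [set: T] (EFin \o (fun=> c)).
  apply/integrableP; split; first exact: measurable_cst.
  by rewrite [ltLHS](integral_cst mu measurableT `|c%:E|%E) [X in (_ * X)%E]mu1 mule1 ltry.
have iF2 : mu.-integrable [set: T] (EFin \o (fun x => F x ^+ 2)).
  apply/integrableP; split => //=.
  under eq_integral => x _ do rewrite ger0_norm ?sqr_ge0//.
  by rewrite ltey.
have iF : mu.-integrable [set: T] (EFin \o F).
  apply: (@le_integrable _ _ _ _ _ _ _ (EFin \o (fun x => 1 + F x ^+ 2))) => //.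
  - exact/measurable_EFinP.
  - move=> x _ /=; rewrite lee_fin ler_normr; apply/orP; left.
    have := sqr_ge0 (`|F x| - 1); rewrite sqrrB real_normK ?num_real//.
    have := sqr_ge0 (F x); lra.
  - exact: (integrableD measurableT (icst 1) iF2).
set m := (\int[mu]_x F x)%R.
have : (\int[mu]_x (2 * m * F x - m ^+ 2) <= \int[mu]_x (F x ^+ 2))%R.
  apply: le_Rintegral => //.
    exact: (integrableB measurableT (integrableZl measurableT (2 * m) iF) (icst (m ^+ 2))).
  by move=> x _; have := sqr_ge0 (F x - m); nra.
have i1 : mu.-integrable [set: T] (EFin \o (fun x => 2 * m * F x)).
  exact: (integrableZl measurableT (2 * m) iF).
rewrite (RintegralB measurableT i1 (icst (m ^+ 2))) RintegralZl// Rintegral_cst//.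
rewrite [X in fine X]mu1 mulr1 -/m => h.
rewrite -[leRHS]fineK; last exact: (integrable_fin_num measurableT iF2).
rewrite lee_fin; apply: le_trans h; rewrite le_eqVlt; apply/orP; left; apply/eqP.
by rewrite -/m; ring.
Qed.

Section Stationary.
Context d (T : measurableType d) (R : realType) (pi : probability T R).
Variable P : R.-pker T ~> T.
Hypothesis statP : stationary pi P.

(** [pi] as a kernel from a point, so that integration against pi P becomes integration against a
    composition of kernels. *)
Let l : R.-pker unit ~> T :=
  kprobability (measurable_cst (pi : pprobability T R) : measurable_fun [set: unit] _).
Let k : R.-spker (unit * T) ~> T := kernel.kernel_snd P.

Lemma integral_stationary (f : T -> \bar R) : measurable_fun [set: T] f ->
  (forall x, 0 <= f x)%E -> (\int[pi]_x (\int[P x]_y f y) = \int[pi]_x f x)%E.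
Proof.
move=> mf f0.
have := @integral_kcomp _ _ _ _ _ _ _ l k tt f f0 mf.
rewrite /= => <-; apply: eq_measure_integral => A mA _.
exact: statP.
Qed.

(** The representative [o] of the constant class is 1 only almost everywhere for [pi], while the
    operator integrates it against [P x]. Stationarity turns [|o - 1|] having integral 0 into
    [o = 1] almost everywhere for [P x], for almost every [x]. *)
Lemma kernel_operator1 :
  kernel_operator pi P (L2class pi (fun=> 1)) = L2class pi (fun=> 1).
Proof.
apply: L2classE; set o := L2class pi (fun=> 1).
have mo : measurable_fun [set: T] (fun y => (o y - 1)%:E).
  by apply/measurable_EFinP; apply: measurable_funB => //; exact: L2_measurable.
pose D x := (\int[P x]_y `|(o y - 1)%:E|)%E.
have mD : measurable_fun [set: T] D.
  apply: measurable_fun_integral_kernel => //.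
  - by move=> U mU; exact: measurable_kernel.
  - exact: measurableT_comp.
have D0 : (\int[pi]_x `|D x| = 0)%E.
  under eq_integral => x _ do rewrite gee0_abs ?integral_ge0//.
  rewrite integral_stationary//; last exact: measurableT_comp.
  apply: (ae_eq_integral_abs pi measurableT mo).2.
  by apply: filterS (L2oneE pi) => x + xT; move=> /(_ xT) ->; rewrite subrr.
apply: filterS2 ((ae_eq_integral_abs pi measurableT mD).1 D0) (L2oneE pi).
move=> x /(_ I) Dx /(_ I) ox _.
have /(ae_eq_integral_abs (P x) measurableT mo) o1 := Dx.
rewrite /Rintegral (@ae_eq_integral _ _ _ _ _ (cst 1%E))//.
- by rewrite integral_cst// mul1e ox [X in fine X](prob_kernel x).
- by apply/measurable_EFinP; exact: L2_measurable.
- apply: filterS o1 => y /(_ I) /= [oy] _; congr EFin.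
  by apply/eqP; rewrite -subr_eq0 oy.
Qed.

Lemma kernel_operator_nonexpansive (f : L2 pi) : `|kernel_operator pi P f| <= `|f|.
Proof.
rewrite -(ler_pXn2r (n := 2))// ?nnegrE// -lee_fin.
rewrite /kernel_operator; set F := fun x => _.
(* Without such a class the operator takes its default value 0, and the bound is trivial. *)
have [exF|noF] := pselect (exists g : L2 pi, (g : T -> R) = F %[ae pi]); last first.
  rewrite /L2class xgetPN; first by rewrite normr0 expr0n/= lee_fin sqr_ge0.
  by move=> g gF; apply: noF; exists g.
have mf2 : measurable_fun [set: T] (fun x => (f x ^+ 2)%:E).
  by apply/measurable_EFinP; apply: measurable_funX; exact: L2_measurable.
have f20 x : (0 <= (f x ^+ 2)%:E)%E by rewrite lee_fin sqr_ge0.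
rewrite !normL2E.
rewrite -(integral_stationary mf2 f20).
apply: ae_ge0_le_integral => //.
- by move=> x _; rewrite lee_fin sqr_ge0.
- by apply/measurable_EFinP; apply: measurable_funX; exact: L2_measurable.
- by move=> x _; exact: integral_ge0.
- by apply: measurable_fun_integral_kernel => // U mU; exact: measurable_kernel.
- apply: filterS (L2classP exF) => x + xT; move=> /(_ xT) ->.
  apply: jensen_sqr; [exact: prob_kernel|exact: L2_measurable].
Qed.
End Stationary.

(** * Averaging over the group *)

Section Koopman.
Context d (T : measurableType d) (R : realType) (pi : probability T R).
Implicit Types (f g h : L2 pi) (phi : T -> T).

Definition koopman phi f : L2 pi := L2class pi (fun x => f (phi x)).

Section preserving.
Context (phi : T -> T) (mp : measure_preserving pi phi).

Lemma measurable_comp_preserving f : measurable_fun [set: T] (fun x => f (phi x)).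
Proof. by apply: measurableT_comp; [exact: L2_measurable|exact: mp.1]. Qed.

Let mf2 f : measurable_fun [set: T] (fun x => (f x ^+ 2)%:E).
Proof. by apply/measurable_EFinP; apply: measurable_funX; exact: L2_measurable. Qed.

Lemma integral_koopman_sqr f :
  (\int[pi]_x (f (phi x) ^+ 2)%:E = (`|f| ^+ 2)%:E)%E.
Proof.
rewrite normL2E (ge0_integral_preserving mp (mf2 f))// => x.
by rewrite lee_fin sqr_ge0.
Qed.

Lemma koopmanE f : (koopman phi f : T -> R) = (fun x => f (phi x)) %[ae pi].
Proof.
apply: L2classP; apply: exists_L2; first exact: measurable_comp_preserving.
by rewrite integral_koopman_sqr ltry.
Qed.

Lemma norm_koopman f : `|koopman phi f| = `|f|.
Proof.
apply/eqP; rewrite -(eqrXn2 (n := 2))//; apply/eqP/EFin_inj.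
by rewrite (normL2_ae (measurable_comp_preserving f) (koopmanE f)) integral_koopman_sqr.
Qed.

Lemma linear_koopman : linear (koopman phi).
Proof.
move=> a u v; apply: L2classE.
have E1 := ae_preserving mp (LspaceDE (a *: u) v).
have E2 := ae_preserving mp (LspaceZE a u).
have E3 := LspaceDE (a *: koopman phi u) (koopman phi v).
have E4 := LspaceZE a (koopman phi u).
have E5 : \forall x \ae pi, koopman phi u x = u (phi x) /\ koopman phi v x = v (phi x).
  by apply: filterS2 (koopmanE u) (koopmanE v) => x /(_ I) -> /(_ I) ->.
have E6 : \forall x \ae pi, (a *: u + v : L2 pi) (phi x) = a * u (phi x) + v (phi x).
  by apply: filterS2 E1 E2 => x /(_ I) -> /(_ I) ->.
apply: filterS2 E5 (filterI E6 (filterI E3 E4)) => x [k1 k2] [-> [/(_ I) -> /(_ I) ->]] _.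
by rewrite k1 k2.
Qed.

Lemma koopman1 : koopman phi (L2class pi (fun=> 1)) = L2class pi (fun=> 1).
Proof.
apply: L2classE.
by apply: filterS2 (L2oneE pi) (ae_preserving mp (L2oneE pi)) => x /(_ I) -> /(_ I) ->.
Qed.
End preserving.

Lemma koopman_comp phi psi : measure_preserving pi phi -> measure_preserving pi psi ->
  forall f, koopman phi (koopman psi f) = koopman (psi \o phi) f.
Proof.
move=> mphi mpsi f; apply: L2classE.
have mpp : measure_preserving pi (psi \o phi).
  split=> [|A mA]; first exact: measurableT_comp mpsi.1 mphi.1.
  rewrite comp_preimage mphi.2 ?mpsi.2// -[_ @^-1` _]setTI.
  exact: mpsi.1.
apply: filterS2 (ae_preserving mphi (koopmanE mpsi f)) (koopmanE mpp f).
by move=> x /(_ I) -> /(_ I) ->.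
Qed.

Lemma koopman_id f : koopman id f = f.
Proof. by apply: L2classE; apply: ae_eq_refl. Qed.

End Koopman.

Lemma open_borel_measurable (X : ptopologicalType) (A : set X) :
  open A -> measurable (A : set (borel X)).
Proof. by move=> oA; exact: sub_sigma_algebra. Qed.

Lemma continuous_borel_measurable (X Y : ptopologicalType) (f : X -> Y) :
  continuous f -> measurable_fun [set: borel X] (f : borel X -> borel Y).
Proof.
move=> /continuousP cf.
apply: (@measurability _ _ (borel X) (borel Y) setT _ (@open Y) erefl).
move=> _ [B oB <-]; rewrite setTI.
by apply: open_borel_measurable; exact: cf.
Qed.

Section Action.
Context (R : realType) (X : ptopologicalType) (G : topologicalGroupType).
Variables (act : G -> X -> X) (pi : probability (borel X) R).
Hypotheses (mact : measurable_action act) (ipi : invariant_measure act pi).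

Lemma act_preserving g : @measure_preserving _ (borel X) R pi (act g).
Proof.
have [act1 actM macts] := mact.
apply: (@image_preserving _ (borel X) R pi (act g) (act g^-1%g)).
- exact: (@measurableT_comp _ _ _ (borel X) (borel G * borel X)%type (borel X)
    (fun gx => act gx.1 gx.2) setT (pair g) macts (pair1_measurable (g : borel G))).
- by move=> x; rewrite -actM mulgV act1.
- exact: ipi.
Qed.

Local Notation U := (@Uop R X G act pi).

Lemma norm_Uop g f : `|U g f| = `|f|.
Proof. exact: norm_koopman (act_preserving g) f. Qed.

Lemma linear_Uop g : linear (U g).
Proof. exact: linear_koopman (act_preserving g). Qed.

Lemma Uop_one g : U g (L2class pi (fun=> 1)) = L2class pi (fun=> 1).
Proof. exact: koopman1 (act_preserving g). Qed.

(** Composition on the right reverses the order of the factors. *)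
Lemma UopM g h f : U g (U h f) = U (h * g)%g f.
Proof.
rewrite [LHS](koopman_comp (act_preserving g) (act_preserving h)).
have [_ actM _] := mact.
by congr (L2class pi _); apply/funext => x /=; rewrite actM.
Qed.

Lemma Uop1 f : U 1%g f = f.
Proof.
have [act1 _ _] := mact; rewrite -[RHS]koopman_id.
by congr (L2class pi _); apply/funext => x /=; rewrite act1.
Qed.

Lemma dotp_Uop g f k : dotp (U g f) k = dotp f (U g^-1%g k).
Proof.
have H := hilbert_L2 pi.
have isom u v : dotp (U g u) (U g v) = dotp u v.
  have := normB_sq H (U g u) (U g v).
  rewrite -(linB (linear_Uop g)) !norm_Uop (normB_sq H) => /eqP.
  by rewrite (can_eq (addrK _)) (can_eq (addKr _)) eqr_opp (inj_eq (mulfI _))// => /eqP.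
by rewrite -[in LHS](Uop1 k) -(mulVg g) -UopM isom.
Qed.

Section average.
Variables (mu : probability (borel G) R).

Let mfact g (f : L2 pi) : measurable_fun [set: borel X] (fun x : borel X => f (act g x)).
Proof.
exact: (measurable_comp_preserving (act_preserving g) f).
Qed.

Lemma EFin_dotp_Uop g f k :
  (dotp (U g f) k)%:E = (\int[pi]_x (f (act g x) * k x)%:E)%E.
Proof.
apply: dotp_ae; last exact: koopmanE (act_preserving g) f.
exact: mfact.
Qed.

(** By Fubini on [mu \x pi], using joint measurability of the action; the integrand is dominated by
    [f (act g x) ^+ 2 + k x ^+ 2], whose integral over [x] does not depend on [g]. *)
Lemma integrable_dotp_Uop f k :
  mu.-integrable [set: borel G] (fun g => (dotp (U g f) k)%:E).
Proof.
pose F (z : borel G * borel X) := (f (act z.1 z.2) * k z.2)%:E.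
have [_ _ macts] := mact.
have mF : measurable_fun [set: borel G * borel X] F.
  apply/measurable_EFinP; apply: measurable_funM.
    exact: measurableT_comp (L2_measurable f) macts.
  exact: measurableT_comp (L2_measurable k) measurable_snd.
have iF : (mu \x pi)%E.-integrable [set: borel G * borel X] F.
  apply: (@integrable12ltyP _ _ _ _ R mu pi F mF).2.
  apply: (@le_lt_trans _ _ (\int[mu]_g (`|f| ^+ 2 + `|k| ^+ 2)%:E)%E); last first.
    by rewrite integral_cst// [X in (_ * X)%E](probability_setT mu) mule1 ltry.
  apply: ge0_le_integral => //.
  - by move=> g _; exact: integral_ge0.
  - apply: (@measurable_fun_fubini_tonelli_F _ _ _ _ _ pi (fun z => `|F z|%E)) => //.
    exact: measurableT_comp.
  - move=> g _; have mfg := mfact g f.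
    have mfg2 : measurable_fun [set: borel X] (fun x => (f (act g x) ^+ 2)%:E).
      by apply/measurable_EFinP; apply: measurable_funX.
    have mk2 : measurable_fun [set: borel X] (fun x => (k x ^+ 2)%:E).
      by apply/measurable_EFinP; apply: measurable_funX; exact: L2_measurable.
    rewrite EFinD -(integral_koopman_sqr (act_preserving g)) normL2E.
    rewrite -ge0_integralD//; first last.
    + by move=> x _; rewrite lee_fin sqr_ge0.
    + by move=> x _; rewrite lee_fin sqr_ge0.
    apply: ge0_le_integral => //.
    + apply: measurableT_comp => //; apply/measurable_EFinP; apply: measurable_funM => //.
      exact: L2_measurable.
    + exact: emeasurable_funD.
    + move=> x _; rewrite /F/= -EFinD lee_fin normrM.
      rewrite -[f _ ^+ 2]real_normK ?num_real// -[k x ^+ 2]real_normK ?num_real//.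
      by have := sqr_ge0 (`|f (act g x)| - `|k x|); nra.
rewrite (_ : (fun g => _) = fubini_F pi F).
  exact: integrable_fubini_F.
by apply/funext => g; rewrite EFin_dotp_Uop.
Qed.

Lemma exists_average : exists Q : L2 pi -> L2 pi, [/\ linear Q,
  forall u, `|Q u| <= `|u| & forall f k, dotp (Q f) k = (\int[mu]_g dotp (U g f) k)%R].
Proof.
have H := hilbert_L2 pi.
have [|||Q [Ql Q1 QE]] := form_operator H
    (b := fun f k => (\int[mu]_g dotp (U g f) k)%R) (M := 1); last first.
- by exists Q; split => // u; rewrite -[leRHS]mul1r.
- move=> f k; rewrite mul1r.
  apply: le_trans (le_normr_Rintegral measurableT (integrable_dotp_Uop f k)) _.
  have icst : mu.-integrable [set: borel G] (EFin \o (fun=> `|f| * `|k|)).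
    exact: finite_measure_integrable_cst.
  apply: le_trans (le_Rintegral measurableT _ icst _) _.
  + exact: integrable_norm (integrable_dotp_Uop f k).
  + by move=> g _; rewrite (le_trans (dot_CS H _ _))// norm_Uop.
  + by rewrite Rintegral_cst// [X in fine X](probability_setT mu) mulr1.
- move=> a u v w.
  rewrite -RintegralZl//; last exact: integrable_dotp_Uop.
  rewrite -RintegralD//; [|exact: integrableZl (integrable_dotp_Uop _ _)
                         |exact: integrable_dotp_Uop].
  apply: eq_Rintegral => g _; rewrite (dotC H) (dotDZl H).
  by rewrite !(dotC H _ (U g w)).
- move=> a u v w.
  rewrite -RintegralZl//; last exact: integrable_dotp_Uop.
  rewrite -RintegralD//; [|exact: integrableZl (integrable_dotp_Uop _ _)
                         |exact: integrable_dotp_Uop].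
  by apply: eq_Rintegral => g _; rewrite linear_Uop (dotDZl H).
Qed.

Hypothesis hmu : haar_measure mu.

Lemma mulg_preserving g : @measure_preserving _ (borel G) R mu (fun h => g * h)%g.
Proof.
have [_ _ left _ _] := hmu.
apply: (@image_preserving _ (borel G) R mu (fun h => g * h)%g (fun h => g^-1 * h)%g).
- have cg : continuous (fun h : G => (g * h)%g).
    move=> h; apply: (@continuous_comp _ _ _ (fun h => (g, h)) (fun xy => (xy.1 * xy.2)%g)).
      by apply: cvg_pair; [exact: cvg_cst|exact: cvg_id].
    exact: mulg_continuous.
  exact: continuous_borel_measurable cg.
- by move=> h; rewrite mulgA mulgV mul1g.
- exact: left.
Qed.

(** Because [U] reverses products, [U h (U g f) = U (g * h) f]: left invariance of [mu] absorbs [g]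
    on the right of [Q]. *)
Lemma average_Uop (Q : L2 pi -> L2 pi) :
  (forall f k, dotp (Q f) k = (\int[mu]_g dotp (U g f) k)%R) ->
  forall g f, Q (U g f) = Q f.
Proof.
move=> QE g f; apply: (dot_inj (hilbert_L2 pi)) => k; rewrite !QE.
have mf := measurable_int mu (integrable_dotp_Uop f k).
have E := integral_preserving (mulg_preserving g) mf.
rewrite /Rintegral -E.
by under eq_integral => h _ do rewrite UopM.
Qed.

End average.
End Action.

(** * Adjoints, square roots and spectral gaps *)

Section Operators.
Context d (T : measurableType d) (R : realType) (pi : probability T R).
Implicit Types (f g h u v w : L2 pi) (A B C S Q : L2 pi -> L2 pi).
Local Notation one := (L2class pi (fun=> 1)).
Local Notation H := (hilbert_L2 pi).

Lemma linear_bounded_operator A M : linear A -> (forall u, `|A u| <= M * `|u|) ->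
  bounded_operator A.
Proof. by move=> Al AM; split => //; exact: bounded_lin_continuous AM. Qed.

Lemma bounded_operator_bound A : bounded_operator A ->
  exists M, forall u, `|A u| <= M * `|u|.
Proof. by move=> [Al Ac]; exact: continuous_lin_bounded. Qed.

Lemma adjoint_ex A : bounded_operator A ->
  bounded_operator (adjoint A) /\ forall f h, dotp (A f) h = dotp f (adjoint A h).
Proof.
move=> bA; have [M AM] := bounded_operator_bound bA.
have [B [Bl BM BE]] := exists_adjoint H bA.1 AM.
suff : [set B | bounded_operator B /\ forall f h, dotp (A f) h = dotp f (B h)] (adjoint A).
  by [].
apply: (@xgetPex _ (fun=> 0)); exists B; split => //.
exact: linear_bounded_operator Bl BM.
Qed.

Lemma adjointE A B : bounded_operator B ->
  (forall f h, dotp (A f) h = dotp f (B h)) -> adjoint A = B.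
Proof.
move=> bB AB.
have [_ E] : [set B | bounded_operator B /\ forall f h, dotp (A f) h = dotp f (B h)] (adjoint A).
  by apply: (@xgetPex _ (fun=> 0)); exists B.
apply/funext => h; apply: (dot_inj H) => f.
by rewrite !(dotC H _ f) -E AB.
Qed.

Lemma adjointK A : bounded_operator A -> adjoint (adjoint A) = A.
Proof.
move=> bA; have [bA' E] := adjoint_ex bA.
by apply: adjointE => // f h; rewrite (dotC H) -E (dotC H).
Qed.

Definition nonexpansive A := linear A /\ forall u, `|A u| <= `|u|.

Lemma nonexpansive_bounded A : nonexpansive A -> bounded_operator A.
Proof.
by move=> [Al A1]; apply: (linear_bounded_operator (M := 1)) => // u; rewrite mul1r.
Qed.

Lemma nonexpansive_dot A : nonexpansive A ->
  forall f h, dotp (A f) h = dotp f (adjoint A h).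
Proof. by move=> cA; have [] := adjoint_ex (nonexpansive_bounded cA). Qed.

(** The square of [|A' f|] is the product of [A (A' f)] with [f]. The bound on [A] is asked only at
    [A' f], so it may hold merely on a subspace such as [L20]. *)
Lemma norm_adjoint_le A (c : R) f : nonexpansive A -> 0 <= c ->
  `|A (adjoint A f)| <= c * `|adjoint A f| -> `|adjoint A f| <= c * `|f|.
Proof.
move=> cA c0 h; have [->|Af0] := eqVneq (`|adjoint A f|) 0; first by rewrite mulr_ge0.
rewrite -(ler_pM2r (x := `|adjoint A f|)) ?lt_def ?Af0 ?normr_ge0//.
rewrite -expr2 -(dotp_norm (adjoint A f)) -nonexpansive_dot//.
apply: le_trans (ler_norm _) _; apply: le_trans (dot_CS H _ _) _.
by rewrite mulrAC ler_wpM2r.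
Qed.

Lemma nonexpansive_adjoint A : nonexpansive A -> nonexpansive (adjoint A).
Proof.
move=> cA; split=> [|u]; first by have [[]] := adjoint_ex (nonexpansive_bounded cA).
by rewrite -[leRHS]mul1r; apply: norm_adjoint_le => //; rewrite mul1r; exact: cA.2.
Qed.

Lemma nonexpansive_comp A B : nonexpansive A -> nonexpansive B -> nonexpansive (A \o B).
Proof.
move=> [Al A1] [Bl B1]; split=> [a u v|u] /=; first by rewrite Bl Al.
by rewrite (le_trans (A1 _)).
Qed.

Lemma adjoint_comp A B : nonexpansive A -> nonexpansive B ->
  adjoint (A \o B) = adjoint B \o adjoint A.
Proof.
move=> cA cB; apply: adjointE => [|f h /=].
  by apply: nonexpansive_bounded; apply: nonexpansive_comp; exact: nonexpansive_adjoint.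
by rewrite !nonexpansive_dot.
Qed.

Lemma compact_operator_seq A : compact_operator A -> compact_seq A.
Proof.
move=> [_ [K AK [cK _]]] u u1.
have [|w [_ wc]] := cK ((A \o u) @ \oo) _.
  by exists 0%N => // n _; apply: AK; exists (u n) => //; exact: u1.
exists w => e n e0.
have [|_ [[m nm <-] wm]] := wc [set A (u m) | m in [set m | (n <= m)%N]]
    (ball w e) _ (nbhsx_ballx w e e0).
  by exists n => // m nm; exists m.
by exists m => //; move: wm; rewrite -ball_normE /ball_/= distrC.
Qed.

Lemma compact_seq_compr A B : nonexpansive B -> compact_seq A -> compact_seq (A \o B).
Proof.
move=> [_ B1] cA u u1; apply: (cA (B \o u)) => n.
exact: le_trans (B1 _) (u1 n).
Qed.

Lemma compact_seq_compl A B : nonexpansive B -> compact_seq A -> compact_seq (B \o A).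
Proof.
move=> [Bl B1] cA u /cA[w wP]; exists (B w) => e n e0.
have [m nm um] := wP e n e0; exists m => //=.
by rewrite -(linB Bl) (le_lt_trans (B1 _)).
Qed.

Section mult_sqrt.
Variable C : L2 pi -> L2 pi.
Hypothesis cC : nonexpansive C.
Local Notation S := (mult_sqrt C).

Lemma mult_sqrt_ex : [/\ bounded_operator S, positive_operator (@dotp _ _ _ pi) S
  & forall u, S (S u) = C (adjoint C u)].
Proof.
have cC' := nonexpansive_adjoint cC.
have cCC := nonexpansive_comp cC cC'.
have CC u v : dotp (C (adjoint C u)) v = dotp (adjoint C u) (adjoint C v).
  by rewrite nonexpansive_dot.
have [||u|S0 [S0p S0b S0E]] := @exists_sqrt _ _ _ H (C \o adjoint C).
- exact: cCC.1.
- by move=> u v /=; rewrite CC [RHS](dotC H) CC (dotC H).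
(* The square of [|u - C C' u|] is [|u|^2 - 2 |C' u|^2 + |C C' u|^2], and the last term is at most
   [|C' u|^2]. *)
- rewrite -(ler_pXn2r (n := 2))// ?nnegrE// (normB_sq H) (dotC H u) /= CC (dot_norm H).
  have : `|C (adjoint C u)| ^+ 2 <= `|adjoint C u| ^+ 2.
    by rewrite ler_pXn2r// ?nnegrE//; exact: cC.2.
  have := sqr_ge0 `|adjoint C u|; lra.
suff : [set S0 : L2 pi -> L2 pi | [/\ bounded_operator S0,
    forall f h, dotp (S0 f) h = dotp f (S0 h),
    forall f, 0 <= dotp f (S0 f) & S0 \o S0 = C \o adjoint C]] S.
  move=> [Sb Sa Sp SE]; split => //; first by split => //; exact: Sb.1.
  by move=> u; rewrite -[LHS]/((S \o S) u) SE.
apply: (@xgetPex _ (fun=> 0)); exists S0; have [S0l S0a S0pos] := S0p; split => //.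
- exact: linear_bounded_operator S0l S0b.
- by apply/funext => u /=; rewrite S0E.
Qed.

Lemma positive_mult_sqrt : positive_operator (@dotp _ _ _ pi) S.
Proof. by have [] := mult_sqrt_ex. Qed.

Lemma linear_mult_sqrt : linear S.
Proof. by have [] := positive_mult_sqrt. Qed.

Lemma mult_sqrt_sym f h : dotp (S f) h = dotp f (S h).
Proof. by have [_ + _] := positive_mult_sqrt; exact. Qed.

Lemma mult_sqrtK u : S (S u) = C (adjoint C u).
Proof. by have [] := mult_sqrt_ex. Qed.

Lemma norm_mult_sqrt u : `|S u| = `|adjoint C u|.
Proof.
apply/eqP; rewrite -(eqrXn2 (n := 2))//; apply/eqP.
by rewrite -!dotp_norm mult_sqrt_sym mult_sqrtK (dotC H) nonexpansive_dot.
Qed.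

Lemma mult_sqrt_le1 u : `|S u| <= `|u|.
Proof. by rewrite norm_mult_sqrt; exact: (nonexpansive_adjoint cC).2. Qed.
End mult_sqrt.

Lemma lambda_gap_ge A (c : R) : @L20_sphere _ _ _ pi !=set0 ->
  (forall f, L20 f -> `|A f| <= c * `|f|) -> 1 - c <= lambda_gap A.
Proof.
move=> [f0 sf0] Ac; apply: lb_le_inf; first by exists (dotp f0 (f0 - A f0)), f0.
move=> _ [f [Lf f1] <-]; rewrite (dotBr H) dotp_norm f1 expr1n lerB//.
apply: le_trans (ler_norm _) _; apply: le_trans (dot_CS H _ _) _.
by rewrite f1 mul1r (le_trans (Ac _ Lf))// f1 mulr1.
Qed.

Lemma gamma_gap_ge C (c : R) : nonexpansive C -> @L20_sphere _ _ _ pi !=set0 ->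
  (forall f, L20 f -> `|adjoint C f| <= c * `|f|) -> 1 - c <= gamma_gap C.
Proof.
move=> cC s0 Cc; apply: lambda_gap_ge => // f Lf.
by rewrite norm_mult_sqrt//; exact: Cc.
Qed.

Lemma gamma_gap_le C f : nonexpansive C -> L20_sphere f ->
  gamma_gap C <= 1 - dotp f (mult_sqrt C f).
Proof.
move=> cC sf; have [Lf f1] := sf.
have -> : 1 - dotp f (mult_sqrt C f) = dotp f (f - mult_sqrt C f).
  by rewrite (dotBr H) dotp_norm f1 expr1n.
apply: ge_inf; last by exists f.
exists 0 => _ [h [Lh h1] <-]; rewrite (dotBr H) dotp_norm h1 expr1n subr_ge0.
apply: le_trans (ler_norm _) _; apply: le_trans (dot_CS H _ _) _.
by rewrite h1 mul1r (le_trans (mult_sqrt_le1 cC _))// h1.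
Qed.

Lemma L20_sphere_scale f : L20 f -> f != 0 -> L20_sphere (`|f|^-1 *: f).
Proof.
move=> Lf f0; have fn : 0 < `|f| by rewrite normr_gt0.
split; first by rewrite /L20/= (dotZl H) [dotp _ _]Lf mulr0.
by rewrite normrZ normfV normr_id mulVf// gt_eqF.
Qed.

Lemma gamma_gap_empty A : @L20_sphere _ _ _ pi = set0 -> gamma_gap A = 0.
Proof. by move=> s0; rewrite /gamma_gap /lambda_gap s0 image_set0 inf0. Qed.

Lemma lambda_gap_empty A : @L20_sphere _ _ _ pi = set0 -> lambda_gap A = 0.
Proof. by move=> s0; rewrite /lambda_gap s0 image_set0 inf0. Qed.

Lemma gamma_gap_le1 C : nonexpansive C -> gamma_gap C <= 1.
Proof.
move=> cC; have [s0|/set0P[f sf]] := eqVneq (@L20_sphere _ _ _ pi) set0.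
  by rewrite gamma_gap_empty.
rewrite (le_trans (gamma_gap_le cC sf))// lerBlDr lerDl.
by have [_ _ ->] := positive_mult_sqrt cC.
Qed.

(* The only properties of Markov kernels with invariant measure [pi], and of the
   [Uop act g], that the comparison of gaps uses. *)
Definition markov_like A := nonexpansive A /\ A one = one.

(** [A' 1] has norm at most 1 and inner product 1 with the unit vector 1, which is the equality case
    of Cauchy-Schwarz. *)
Lemma markov_like_adjoint A : markov_like A -> markov_like (adjoint A).
Proof.
move=> [cA A1]; split; first exact: nonexpansive_adjoint.
apply/eqP; rewrite -subr_eq0 -normr_eq0 -sqrf_eq0 eq_le sqr_ge0 andbT.
rewrite (normB_sq H) (dotC H) -nonexpansive_dot// A1 (dot_norm H) normL2one expr1n.
have : `|adjoint A one| ^+ 2 <= 1 ^+ 2.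
  by rewrite ler_pXn2r ?nnegrE// -[leRHS](normL2one pi) (nonexpansive_adjoint cA).2.
lra.
Qed.

Lemma markov_like_comp A B : markov_like A -> markov_like B -> markov_like (A \o B).
Proof.
by move=> [cA A1] [cB B1]; split; [exact: nonexpansive_comp|rewrite /= B1].
Qed.

Lemma markov_like_L20 A f : markov_like A -> L20 f -> L20 (A f).
Proof.
move=> mA Lf; rewrite /L20/= nonexpansive_dot; last exact: mA.1.
by rewrite (markov_like_adjoint mA).2.
Qed.

Lemma mult_sqrt1 C : markov_like C -> mult_sqrt C one = one.
Proof.
move=> mC; have Sp := positive_mult_sqrt mC.1.
rewrite -[RHS]scale1r; apply: (positive_opBr H) => //.
by rewrite mult_sqrtK ?(markov_like_adjoint mC).2 ?mC.2 ?expr1n ?scale1r//; exact: mC.1.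
Qed.

Lemma mult_sqrt_L20 C f : markov_like C -> L20 f -> L20 (mult_sqrt C f).
Proof.
by move=> mC Lf; rewrite /L20/= mult_sqrt_sym ?mult_sqrt1//; exact: mC.1.
Qed.

Lemma norm_mult_sqrt_gap C f : markov_like C -> L20 f ->
  `|mult_sqrt C f| <= (1 - gamma_gap C) * `|f|.
Proof.
move=> mC; have cC := mC.1; move: f.
apply: (positive_op_norm H (positive_mult_sqrt cC)) => [||u Lu].
- by rewrite subr_ge0 gamma_gap_le1.
- by move=> u; exact: mult_sqrt_L20.
have [->|u0] := eqVneq u 0; first by rewrite (dot0l H) normr0 expr0n mulr0.
have := gamma_gap_le cC (L20_sphere_scale Lu u0).
rewrite (linZ (linear_mult_sqrt cC)) (dotZl H) (dotZr H) lerBrDr -lerBrDl.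
have un : 0 < `|u| by rewrite normr_gt0.
by rewrite mulrA -expr2 exprVn mulrC ler_pdivrMr ?exprn_gt0.
Qed.

Lemma norm_adjoint_gap C f : markov_like C -> L20 f ->
  `|adjoint C f| <= (1 - gamma_gap C) * `|f|.
Proof. by move=> mC Lf; rewrite -norm_mult_sqrt ?norm_mult_sqrt_gap//; exact: mC.1. Qed.

(** [C] is the adjoint of its adjoint, so [norm_adjoint_le] carries the bound on the adjoint over to
    [C]. *)
Lemma norm_gap C f : markov_like C -> L20 f -> `|C f| <= (1 - gamma_gap C) * `|f|.
Proof.
move=> mC Lf; have mC' := markov_like_adjoint mC.
rewrite -{1}(adjointK (nonexpansive_bounded mC.1)).
apply: norm_adjoint_le; first exact: mC'.1.
  by rewrite subr_ge0 gamma_gap_le1//; exact: mC.1.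
apply: norm_adjoint_gap => //; rewrite adjointK; last exact: nonexpansive_bounded mC.1.
exact: markov_like_L20.
Qed.

Lemma gamma_gap_adjoint C : markov_like C -> gamma_gap (adjoint C) = gamma_gap C.
Proof.
have [s0|/set0P s0] := eqVneq (@L20_sphere _ _ _ pi) set0.
  by rewrite !gamma_gap_empty.
have le A : markov_like A -> gamma_gap A <= gamma_gap (adjoint A).
  move=> mA; rewrite -[leLHS](subKr 1); apply: gamma_gap_ge => //.
    exact: (markov_like_adjoint mA).1.
  move=> f Lf; rewrite adjointK; last exact: nonexpansive_bounded mA.1.
  exact: norm_gap.
move=> mC; apply: le_anti; rewrite le// andbT.
by rewrite -[in leRHS](adjointK (nonexpansive_bounded mC.1)) le//; exact: markov_like_adjoint.
Qed.

Lemma gamma_gap_ge0 C : markov_like C -> 0 <= gamma_gap C.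
Proof.
have [s0|/set0P s0] := eqVneq (@L20_sphere _ _ _ pi) set0.
  by rewrite gamma_gap_empty.
move=> mC; rewrite -[leLHS](subrr 1); apply: gamma_gap_ge => //; first exact: mC.1.
by move=> f _; rewrite mul1r; exact: (nonexpansive_adjoint mC.1).2.
Qed.

Lemma gamma_gap_comp C D : markov_like C -> markov_like D ->
  Num.max (gamma_gap C) (gamma_gap D) <= gamma_gap (C \o D).
Proof.
move=> mC mD; have [s0|/set0P s0] := eqVneq (@L20_sphere _ _ _ pi) set0.
  by rewrite !gamma_gap_empty// maxxx.
have mCD := markov_like_comp mC mD.
rewrite ge_max; apply/andP; split; rewrite -[leLHS](subKr 1);
  apply: gamma_gap_ge => //; (try exact: mCD.1); move=> f Lf;
  (rewrite adjoint_comp; [|exact: mC.1|exact: mD.1]); rewrite /=.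
- apply: le_trans ((nonexpansive_adjoint mD.1).2 _) _.
  exact: norm_adjoint_gap.
- have := norm_adjoint_gap mD (markov_like_L20 (markov_like_adjoint mC) Lf).
  move/le_trans; apply; rewrite ler_wpM2l ?subr_ge0 ?gamma_gap_le1//; first exact: mD.1.
  exact: (nonexpansive_adjoint mC.1).2.
Qed.

End Operators.

(** * The bound in terms of beta *)

Section OrthProj.
Context d (T : measurableType d) (R : realType) (pi : probability T R).
Implicit Types (f g h u v w : L2 pi) (V W : set (L2 pi)).
Local Notation H := (hilbert_L2 pi).

Lemma orth_projP W : closed_subspace W -> forall f,
  W (orth_proj W f) /\ forall h, W h -> dotp (f - orth_proj W f) h = 0.
Proof.
move=> cW.
suff : [set Q : L2 pi -> L2 pi | forall f, W (Q f) /\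
    forall h, W h -> dotp (f - Q f) h = 0] (orth_proj W) by [].
have [Q QP] : {Q : L2 pi -> L2 pi & forall f, W (Q f) /\
    forall h, W h -> dotp (f - Q f) h = 0}.
  apply: (@choice _ _ (fun f q => W q /\ forall h, W h -> dotp (f - q) h = 0)) => f.
  by have [q Wq qP] := projection H f cW; exists q.
by apply: (@xgetPex _ (fun=> 0)); exists Q.
Qed.

Lemma dotp_orth_proj W f h : closed_subspace W -> W h ->
  dotp (orth_proj W f) h = dotp f h.
Proof.
move=> cW Wh; have [_ /(_ h Wh)/eqP] := orth_projP cW f.
by rewrite (dotBl H) subr_eq0 => /eqP.
Qed.

Lemma norm_orth_proj W f : closed_subspace W ->
  `|f| ^+ 2 = `|orth_proj W f| ^+ 2 + `|f - orth_proj W f| ^+ 2.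
Proof.
move=> cW; have [Wp pP] := orth_projP cW f.
rewrite -(pythagoras H) ?(addrC (orth_proj W f)) ?subrK//.
by rewrite (dotC H) pP.
Qed.

Lemma orth_proj_le W f : closed_subspace W -> `|orth_proj W f| <= `|f|.
Proof.
move=> cW; rewrite -(ler_pXn2r (n := 2))// ?nnegrE// (norm_orth_proj f cW).
by rewrite lerDl sqr_ge0.
Qed.

Lemma orth_proj_id W f : closed_subspace W -> W f -> orth_proj W f = f.
Proof.
move=> cW Wf; have [Wp pP] := orth_projP cW f.
apply/esym/eqP; rewrite -subr_eq0 -(dot_eq0 H) pP//.
exact: subspaceB.
Qed.

Lemma closed_L20 : closed_subspace (@L20 d T R pi).
Proof.
have := closed_subspace_orth H [set L2class pi (fun=> 1)].
rewrite (_ : [set u | _] = @L20 d T R pi)//.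
by apply/seteqP; split=> [u /(_ _ erefl)//|u Lu _ ->].
Qed.
End OrthProj.

Section SpectralBound.
Context d (T : measurableType d) (R : realType) (pi : probability T R).
Implicit Types (f g h u v w : L2 pi).
Local Notation H := (hilbert_L2 pi).
Local Notation one := (L2class pi (fun=> 1)).
Variable A : L2 pi -> L2 pi.
(** Compactness is asked of the square of [S]; this can be met by a compact operator and by its
    adjoint, by composition alone. *)
Hypotheses (mA : markov_like A) (cA : compact_seq (A \o adjoint A)).
Hypothesis sphere : @L20_sphere d T R pi !=set0.
Variable V : set (L2 pi).
Hypothesis cV : closed_subspace V.

Let S := mult_sqrt A.
Let s := 1 - gamma_gap A.
Let W := Wtilde A.
Let Spos : positive_operator (@dotp _ _ _ pi) S := positive_mult_sqrt mA.1.
Let Sl : linear S := linear_mult_sqrt mA.1.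

Let Scompact : compact_seq (S \o S).
Proof.
rewrite (_ : S \o S = A \o adjoint A)//.
by apply/funext => u /=; rewrite [LHS](mult_sqrtK mA.1).
Qed.

Let S_le u : `|S u| <= 1 * `|u|.
Proof. by rewrite mul1r; exact: mult_sqrt_le1 mA.1 u. Qed.

Let s0 : 0 <= s.
Proof. by rewrite subr_ge0; exact: gamma_gap_le1 mA.1. Qed.

Let s1 : s <= 1.
Proof. by rewrite lerBlDr lerDl; exact: gamma_gap_ge0. Qed.

Lemma WtildeE f : W f <-> S f = s *: f.
Proof.
rewrite /W /Wtilde /= /s scalerBl scale1r; split=> [<-|E]; first by rewrite subKr.
by rewrite -[mult_sqrt A f]/(S f) E subKr.
Qed.

Lemma closed_Wtilde : closed_subspace W.
Proof.
have -> : W = [set f | S f - s *: f = 0].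
  apply/seteqP; split=> f; first by move/WtildeE => /= ->; rewrite subrr.
  by move=> /= /eqP; rewrite subr_eq0 => /eqP /WtildeE.
apply: (@closed_subspace_ker _ _ (fun f => S f - s *: f) (1 + 1)) => [a u v|u].
  by rewrite Sl (scalerDr s) scalerBr !scalerA (mulrC s) opprD addrACA.
rewrite (le_trans (ler_normB _ _))// mulrDl lerD// mul1r.
by rewrite normrZ ger0_norm// ler_piMl.
Qed.

Let S_L20 u : L20 u -> `|S u| <= s * `|u|.
Proof. exact: norm_mult_sqrt_gap. Qed.

(* If [S] had norm [s] on [V], compactness would give an eigenvector for [s] in [V]. *)
Lemma strict_contraction : 0 < s -> (forall f, W f -> V f -> f = 0) ->
  exists2 c : R, c < s & forall u, V u -> L20 u -> `|S u| <= c * `|u|.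
Proof.
move=> sp WV; apply: contrapT => nc.
have [|u [[Vu Lu] u1 Su]] := @top_eigenvector _ _ _ H S 1 (@L20 _ _ _ pi) (V `&` @L20 _ _ _ pi) s
    Spos S_le Scompact (fun u Lu => mult_sqrt_L20 mA Lu) S_L20
    (closed_subspaceI cV (closed_L20 pi)) (fun u uV => uV.2) sp.
  (* If no unit vector of the subspace exceeds [s - e], then [s - e] is itself a contraction
     constant below [s]. *)
  move=> e e0; apply: contrapT => ne; apply: nc; exists (s - e); first by rewrite ltrBlDr ltrDl.
  move=> u Vu Lu; have [->|u0] := eqVneq u 0; first by rewrite (lin0 Sl) normr0 mulr0.
  have un : 0 < `|u| by rewrite normr_gt0.
  rewrite leNgt; apply/negP => uS; apply: ne; exists (`|u|^-1 *: u); split.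
  - by split; [exact: subspaceZ|exact: (L20_sphere_scale Lu u0).1].
  - exact: (L20_sphere_scale Lu u0).2.
  - by rewrite (linZ Sl) normrZ normfV normr_id mulrC ltr_pdivlMr.
have u0 : u = 0 by apply: WV => //; apply/WtildeE.
by move: u1; rewrite u0 normr0 => /esym/eqP; rewrite oner_eq0.
Qed.

Variable gamma2 : R.
Hypotheses (g2gt : gamma_gap A < gamma2) (g2le1 : gamma2 <= 1).
(** The clause [c < 1] restricts minimality to the eigenvalues that pass between an operator and its
    adjoint. *)
Hypothesis g2min : forall c, is_eigenvalue (fun f => f - S f) c ->
  gamma_gap A < c -> c < 1 -> gamma2 <= c.

Let s2 := 1 - gamma2.

Let N : set (L2 pi) := [set u | forall w, W w -> dotp u w = 0] `&` @L20 d T R pi.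

Let N_S u : N u -> N (S u).
Proof.
move=> [uW Lu]; split=> [w Ww|]; last exact: mult_sqrt_L20.
have /WtildeE Sw := Ww.
by rewrite (mult_sqrt_sym mA.1) [mult_sqrt A w]Sw (dotZr H) uW ?mulr0.
Qed.

(** The supremum [t] of [|S u|] over unit vectors of [N] is, if positive, an eigenvalue with
    eigenvector in [N]. It is not [s], since [N] is orthogonal to [W], so [1 - t] exceeds the gap
    and is at least [gamma2]. *)
Let norm_N u : N u -> `|S u| <= s2 * `|u|.
Proof.
have s20 : 0 <= s2 by rewrite subr_ge0.
have cN : closed_subspace N.
  by apply: closed_subspaceI; [exact: (closed_subspace_orth H W)|exact: closed_L20].
pose D := [set `|S u| | u in N `&` [set u | `|u| = 1]].
have Dub : has_ubound D.
  by exists 1 => _ [v [_ /= v1] <-]; rewrite (le_trans (S_le v))// v1 mulr1.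
pose t := sup D.
have Nt v : N v -> `|S v| <= t * `|v|.
  move=> Nv; have [->|v0] := eqVneq v 0; first by rewrite (lin0 Sl) normr0 mulr0.
  have vn : 0 < `|v| by rewrite normr_gt0.
  rewrite -ler_pdivrMr//; apply: ub_le_sup => //; exists (`|v|^-1 *: v).
    split; first exact: subspaceZ.
    by rewrite /= normrZ normfV normr_id mulVf// gt_eqF.
  by rewrite (linZ Sl) normrZ normfV normr_id mulrC.
move=> Nu; apply: le_trans (Nt _ Nu) _; rewrite ler_wpM2r//.
have [t0|tp] := leP t 0; first exact: le_trans t0 s20.
have D0 : D !=set0.
  apply/set0P/eqP => D0; move: tp; rewrite /t D0 sup0 ltxx//.
have [||v [Nv v1 Sv]] := @top_eigenvector _ _ _ H S 1 N N t Spos S_le Scompact N_S Nt cN _ tp.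
- by [].
- move=> e e0; have [_ [v [Nv v1] <-] vt] := sup_adherent e0 (conj D0 Dub).
  by exists v.
have ts : t <= s.
  have := S_L20 Nv.2; rewrite Sv normrZ v1 !mulr1.
  by rewrite ger0_norm// ltW.
have {}ts : t < s.
  rewrite lt_neqAle ts andbT; apply/eqP => tE.
  have Wv : W v by apply/WtildeE; rewrite Sv tE.
  have /eqP := Nv.1 v Wv; rewrite (dot_eq0 H) => /eqP v0.
  by move: v1; rewrite v0 normr0 => /esym/eqP; rewrite oner_eq0.
rewrite /s2 lerBrDr addrC -lerBrDr; apply: g2min.
- exists v; first by rewrite -normr_eq0 v1 oner_eq0.
  by rewrite Sv scalerBl scale1r.
- by move: ts; rewrite /s; lra.
- by rewrite ltrBlDr ltrDl.
Qed.

Let b := opnorm0 (orth_proj V \o orth_proj W \o orth_proj V).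

Let b_ub : has_ubound [set `|(orth_proj V \o orth_proj W \o orth_proj V) f| |
  f in @L20_sphere d T R pi].
Proof.
exists 1 => _ [u [_ u1] <-] /=; rewrite -[leRHS]u1.
rewrite (le_trans (orth_proj_le _ cV))// (le_trans (orth_proj_le _ closed_Wtilde))//.
exact: orth_proj_le.
Qed.

Lemma beta_ge0 : 0 <= b.
Proof.
have [f sf] := sphere; apply: le_trans (ub_le_sup b_ub _); last by exists f.
exact: normr_ge0.
Qed.

Lemma beta_le1 : b <= 1.
Proof.
apply: ge_sup.
  have [f sf] := sphere.
  by exists (`|(orth_proj V \o orth_proj W \o orth_proj V) f|), f.
move=> _ [u [_ u1] <-] /=; rewrite -[leRHS]u1.
rewrite (le_trans (orth_proj_le _ cV))// (le_trans (orth_proj_le _ closed_Wtilde))//.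
exact: orth_proj_le.
Qed.

(** [W] lives in all of L^2. If [s = 1], it contains the constants and the projection keeps the
    mean; otherwise eigenvectors for [s] are orthogonal to the constants, which have eigenvalue
    1. *)
Let L20_orth_proj f : L20 f -> L20 (orth_proj W f).
Proof.
move=> Lf; have [Wp _] := orth_projP closed_Wtilde f.
have S1 := mult_sqrt1 mA.
have [sE|sN] := eqVneq s 1.
  have W1 : W one by apply/WtildeE; rewrite sE scale1r.
  by rewrite /L20/= dotp_orth_proj//; exact: closed_Wtilde.
have /eqP : dotp (S (orth_proj W f)) one = dotp (orth_proj W f) one.
  by rewrite (mult_sqrt_sym mA.1) [mult_sqrt A _]S1.
rewrite ((WtildeE _).1 Wp) (dotZl H) -subr_eq0 -{2}[dotp _ _]mul1r -mulrBl.
by rewrite mulf_eq0 subr_eq0 (negbTE sN) => /eqP.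
Qed.

(** Split [v] into its part [p] in [W] and the rest in [N]; [S] keeps the two parts orthogonal, with
    factor [s] on the first and at most [s2] on the second. *)
Let unit_bound v : V v -> L20_sphere v -> `|S v| ^+ 2 <= b * s ^+ 2 + (1 - b) * s2 ^+ 2.
Proof.
move=> Vv sv; have [Lv v1] := sv.
have [Wp pP] := orth_projP closed_Wtilde v.
set p := orth_proj W v in Wp pP.
have Nr : N (v - p).
  by split=> //; apply: subspaceB => //; [exact: closed_L20|exact: L20_orth_proj].
have /WtildeE Sp := Wp.
have -> : `|S v| ^+ 2 = s ^+ 2 * `|p| ^+ 2 + `|S (v - p)| ^+ 2.
  rewrite -{1}(subrK p v) addrC (linD Sl) (pythagoras H).
    by rewrite Sp normrZ exprMn real_normK ?num_real.
  rewrite Sp (dotZl H) (dotC H) (mult_sqrt_sym mA.1) [mult_sqrt A p]Sp (dotZr H).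
  by rewrite pP// !mulr0.
have pv : `|p| ^+ 2 + `|v - p| ^+ 2 = 1.
  by rewrite -(norm_orth_proj _ closed_Wtilde) v1 expr1n.
(* As [v] lies in [V], the quadratic form of the triple projection at [v] is exactly [|p| ^+ 2]. *)
have pb : `|p| ^+ 2 <= b.
  have -> : `|p| ^+ 2 = dotp ((orth_proj V \o orth_proj W \o orth_proj V) v) v.
    rewrite /= (orth_proj_id cV Vv) -/p dotp_orth_proj//.
    by rewrite -dotp_norm (dotp_orth_proj _ closed_Wtilde Wp) (dotC H).
  apply: le_trans (ler_norm _) _; apply: le_trans (dot_CS H _ _) _.
  by rewrite v1 mulr1; apply: ub_le_sup; [exact: b_ub|exists v].
have s2r : `|S (v - p)| ^+ 2 <= s2 ^+ 2 * `|v - p| ^+ 2.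
  rewrite -exprMn ler_pXn2r ?nnegrE//; first exact: norm_N.
  by rewrite mulr_ge0// subr_ge0.
have s20 : 0 <= s2 by rewrite subr_ge0.
have s22 : s2 ^+ 2 <= s ^+ 2.
  rewrite ler_pXn2r ?nnegrE//; move: g2gt; rewrite /s2 /s; lra.
have rE : `|v - p| ^+ 2 = 1 - `|p| ^+ 2 by move: pv; move: (`|v - p| ^+ 2) (`|p| ^+ 2) => x y; lra.
move: s2r; rewrite rE => s2r; apply: le_trans (lerD (lexx _) s2r) _.
(* The estimate is affine in [|p| ^+ 2] with slope [s ^+ 2 - s2 ^+ 2 >= 0], so [b] may replace
   [|p| ^+ 2]. *)
move: (`|p| ^+ 2) (s ^+ 2) (s2 ^+ 2) pb s22 => x y z xb zy.
rewrite -subr_ge0 (_ : _ - _ = (b - x) * (y - z)); last by ring.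
by rewrite mulr_ge0// subr_ge0.
Qed.

Let c := Num.sqrt (b * s ^+ 2 + (1 - b) * s2 ^+ 2).

Let c2_ge0 : 0 <= b * s ^+ 2 + (1 - b) * s2 ^+ 2.
Proof. by rewrite addr_ge0// mulr_ge0 ?sqr_ge0 ?beta_ge0// subr_ge0 beta_le1. Qed.

Lemma norm_mult_sqrt_beta v : V v -> L20 v -> `|S v| <= c * `|v|.
Proof.
move=> Vv Lv; have [->|v0] := eqVneq v 0; first by rewrite (lin0 Sl) normr0 mulr0.
have vn : 0 < `|v| by rewrite normr_gt0.
have := unit_bound (subspaceZ (`|v|^-1) cV Vv) (L20_sphere_scale Lv v0).
rewrite (linZ Sl) normrZ normfV normr_id -ler_sqrt// sqrtr_sqr.
by rewrite ger0_norm ?mulr_ge0// mulrC ler_pdivrMr.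
Qed.

Lemma beta_bound_ge : gamma_gap A <= 1 - c.
Proof.
rewrite lerBrDr addrC -lerBrDr -[leRHS]ger0_norm// -sqrtr_sqr ler_sqrt ?sqr_ge0//.
have s20 : 0 <= s2 by rewrite subr_ge0.
have s22 : s2 ^+ 2 <= s ^+ 2.
  rewrite ler_pXn2r ?nnegrE//; move: g2gt; rewrite /s2 /s; lra.
have b1 := beta_le1; rewrite -subr_ge0.
rewrite (_ : _ - _ = (1 - b) * (s ^+ 2 - s2 ^+ 2)); last by rewrite -/s; ring.
by rewrite mulr_ge0// subr_ge0.
Qed.
End SpectralBound.

(** * Weak integrals of operators *)

Section Expectation.
Context d (T : measurableType d) (R : realType) (pi : probability T R).
Context d' (O : measurableType d') (nu : {measure set O -> \bar R}).
Variable A : O -> L2 pi -> L2 pi.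
Local Notation H := (hilbert_L2 pi).
Local Notation one := (L2class pi (fun=> 1)).

Definition is_weak_integral (B : L2 pi -> L2 pi) := bounded_operator B /\ forall f h,
  nu.-integrable [set: O] (fun w => (dotp (A w f) h)%:E) /\
  dotp (B f) h = (\int[nu]_w dotp (A w f) h)%R.

Lemma EoperatorE B : is_weak_integral B -> Eoperator nu A = B.
Proof.
move=> wB.
have [_ E] : is_weak_integral (Eoperator nu A) by apply: (@xgetPex _ (fun=> 0)); exists B.
by apply/funext => f; apply: (dot_inj H) => h; rewrite (E f h).2 (wB.2 f h).2.
Qed.

Lemma EoperatorP : Eoperator nu A = (fun=> 0) \/ is_weak_integral (Eoperator nu A).
Proof.
have [ex|nex] := pselect (exists B, is_weak_integral B).
  by right; exact: (@xgetPex _ (fun=> 0)).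
by left; apply: xgetPN => B wB; apply: nex; exists B.
Qed.

Hypothesis nu1 : nu [set: O] = 1%E.

Lemma norm_weak_integral B f (c : R) : is_weak_integral B -> 0 <= c ->
  (forall w, `|A w f| <= c) -> `|B f| <= c.
Proof.
move=> [_ BE] c0 Ac; have [->|Bf0] := eqVneq (`|B f|) 0; first by [].
rewrite -(ler_pM2r (x := `|B f|)) ?lt_def ?Bf0 ?normr_ge0//.
rewrite -expr2 -(dotp_norm (B f)) (BE f (B f)).2.
have icst : nu.-integrable [set: O] (EFin \o (fun=> c * `|B f|)).
  apply/integrableP; split; first exact: measurable_cst.
  rewrite [ltLHS](integral_cst nu measurableT `|(c * `|B f|)%:E|%E).
  by rewrite [X in (_ * X)%E]nu1 mule1 ltry.
apply: le_trans (le_Rintegral measurableT (BE f (B f)).1 icst _) _.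
  move=> w _; apply: le_trans (ler_norm _) _; apply: le_trans (dot_CS H _ _) _.
  by rewrite ler_wpM2r.
by rewrite Rintegral_cst// [X in fine X]nu1 mulr1.
Qed.

Lemma weak_integral_fix B f h : is_weak_integral B -> (forall w, A w f = h) -> B f = h.
Proof.
move=> [_ BE] Af; apply: (dot_inj H) => k; rewrite (BE f k).2.
under eq_Rintegral do rewrite Af.
by rewrite Rintegral_cst// [X in fine X]nu1 mulr1.
Qed.

Lemma markov_like_weak_integral B : is_weak_integral B ->
  (forall w, markov_like (A w)) -> markov_like B.
Proof.
move=> wB mA; split; first split; first exact: wB.1.1.
  by move=> u; apply: norm_weak_integral => // w; exact: (mA w).1.2.
by apply: weak_integral_fix => // w; exact: (mA w).2.
Qed.
End Expectation.

Section ZeroOperator.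
Context d (T : measurableType d) (R : realType) (pi : probability T R).
Local Notation H := (hilbert_L2 pi).

Lemma nonexpansive0 : nonexpansive (fun=> 0 : L2 pi).
Proof. by split=> [a u v|u]; rewrite ?scaler0 ?addr0 ?normr0. Qed.

Lemma gamma_gap0 : @L20_sphere d T R pi !=set0 -> 1 <= gamma_gap (fun=> 0 : L2 pi).
Proof.
move=> s0; rewrite -[leLHS]subr0; apply: gamma_gap_ge => //; first exact: nonexpansive0.
move=> f _; rewrite (@adjointE _ _ _ _ _ (fun=> 0)) ?normr0 ?mul0r//.
  exact: nonexpansive_bounded nonexpansive0.
by move=> u v; rewrite (dot0l H) (dot0r H).
Qed.

Lemma lambda_gap0 : @L20_sphere d T R pi !=set0 -> 1 <= lambda_gap (fun=> 0 : L2 pi).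
Proof.
move=> s0; rewrite -[leLHS]subr0; apply: lambda_gap_ge => // f _.
by rewrite normr0 mul0r.
Qed.
End ZeroOperator.

(** * Group averages and their gaps *)

Section GroupAverage.
Context (R : realType) (X : ptopologicalType) (G : topologicalGroupType).
Variables (act : G -> X -> X) (pi : probability (borel X) R).
Hypotheses (mact : measurable_action act) (ipi : invariant_measure act pi).
Local Notation H := (hilbert_L2 pi).
Local Notation one := (L2class pi (fun=> 1)).
Local Notation U := (@Uop R X G act pi).
Local Notation V := (Vspace act pi).
Implicit Types (f k u v : L2 pi) (A B C : L2 pi -> L2 pi).

Lemma markov_like_Uop g : markov_like (U g).
Proof.
split; [split; [exact: linear_Uop|]|exact: Uop_one].
by move=> u; rewrite norm_Uop.
Qed.

Lemma closed_Vspace : closed_subspace V.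
Proof.
split=> [g|a u v Vu Vv g|u uP g]; first exact: lin0 (linear_Uop mact ipi g).
  by rewrite linear_Uop// Vu Vv.
apply/eqP; rewrite -subr_eq0; apply/eqP; apply: (@eps_eq0 _ _ _ (1 + 1)) => e /uP[v Vv vu].
rewrite -(subrKA (U g v)) {2}(Vv g) -(linB (linear_Uop mact ipi g)).
rewrite (le_trans (ler_normD _ _))// norm_Uop// mulrDl mul1r lerD// ?(ltW vu)//.
by rewrite distrC ltW.
Qed.

Section Pda.
Variables (nu : probability (borel G * borel G)%type R) (A : L2 pi -> L2 pi).
Hypothesis mA : markov_like A.

Let mUAU (gh : borel G * borel G) : markov_like (U gh.1 \o A \o U gh.2).
Proof.
by apply: markov_like_comp; [apply: markov_like_comp => //|]; exact: markov_like_Uop.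
Qed.

(* If the weak integral does not exist then [Pda act nu A] is [fun=> 0], whose gaps
   are at least 1 (unless [L20] is trivial, when all gaps are [inf set0 = 0]). *)
Lemma Pda_gaps : gamma_gap A <= gamma_gap (Pda act nu A) /\
  gamma_gap A <= lambda_gap (Pda act nu A).
Proof.
have [s0|/set0P s0] := eqVneq (@L20_sphere _ _ _ pi) set0.
  by rewrite (lambda_gap_empty _ s0) !(gamma_gap_empty _ s0).
have gA1 := gamma_gap_le1 mA.1.
have [E|wB] := @EoperatorP _ _ _ pi _ _ nu (fun gh => U gh.1 \o A \o U gh.2).
  by rewrite /Pda E; split; apply: le_trans gA1 _; [exact: gamma_gap0|exact: lambda_gap0].
rewrite -/(Pda act nu A) in wB; set B := Pda act nu A in wB *.
have mB : markov_like B := markov_like_weak_integral (probability_setT nu) wB mUAU.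
have nB f : L20 f -> `|B f| <= (1 - gamma_gap A) * `|f|.
  move=> Lf; apply: (norm_weak_integral (probability_setT nu) wB) => [|gh].
    by rewrite mulr_ge0// subr_ge0.
  rewrite /= norm_Uop// -[in leRHS](norm_Uop mact ipi gh.2 f).
  by apply: norm_gap => //; apply: markov_like_L20 => //; exact: markov_like_Uop.
split; rewrite -[leLHS](subKr 1); last exact: lambda_gap_ge.
apply: gamma_gap_ge => // [|f Lf]; first exact: mB.1.
apply: norm_adjoint_le; [exact: mB.1|by rewrite subr_ge0|].
by apply: nB; apply: markov_like_L20 => //; exact: markov_like_adjoint.
Qed.
End Pda.

Section Average.
Variable mu : probability (borel G) R.
Hypothesis hmu : haar_measure mu.
Variable Q : L2 pi -> L2 pi.
Hypothesis wQ : is_weak_integral mu U Q.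

Lemma markov_like_average : markov_like Q.
Proof.
apply: (markov_like_weak_integral (probability_setT mu) wQ) => g.
exact: markov_like_Uop.
Qed.

Let QE f k : dotp (Q f) k = (\int[mu]_g dotp (U g f) k)%R := (wQ.2 f k).2.

Lemma average_fix v : V v -> Q v = v.
Proof. exact: (weak_integral_fix (probability_setT mu) wQ). Qed.

Lemma adjoint_average_V f : V (adjoint Q f).
Proof.
move=> g; apply: (dot_inj H) => k; have cQ := markov_like_average.1.
by rewrite dotp_Uop// (dotC H) -(nonexpansive_dot cQ) (average_Uop mact ipi hmu QE)
  (nonexpansive_dot cQ) (dotC H).
Qed.

(* Left invariance of [mu] puts the range of the adjoint of [Q] in [V], where [Q] is
   the identity; so [Q] composed with its adjoint is that adjoint, and [Q] is
   self-adjoint without any appeal to right invariance of [mu]. *)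
Lemma adjoint_average : adjoint Q = Q.
Proof.
have cQ := markov_like_average.1; have cQ' := nonexpansive_adjoint cQ.
have QQ : Q \o adjoint Q = adjoint Q.
  by apply/funext => f /=; rewrite average_fix//; exact: adjoint_average_V.
have := adjoint_comp cQ cQ'.
by rewrite QQ (adjointK (nonexpansive_bounded cQ)) QQ => <-.
Qed.

Lemma average_V f : V (Q f).
Proof. by rewrite -adjoint_average; exact: adjoint_average_V. Qed.

Lemma PlaE A : nonexpansive A -> Pla act mu A = Q \o A.
Proof.
move=> cA; apply: EoperatorE; split=> [|f k /=]; last exact: (wQ.2 (A f) k).
by apply: nonexpansive_bounded; apply: nonexpansive_comp => //; exact: markov_like_average.1.
Qed.

Lemma PraE A : nonexpansive A -> Pra act mu A = A \o Q.
Proof.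
move=> cA; apply: EoperatorE; split=> [|f k /=].
  by apply: nonexpansive_bounded; apply: nonexpansive_comp => //; exact: markov_like_average.1.
have [i e] := wQ.2 f (adjoint A k).
have AE g : dotp (A (U g f)) k = dotp (U g f) (adjoint A k) := nonexpansive_dot cA _ _.
rewrite (nonexpansive_dot cA) e; split; last by apply: eq_Rintegral => g _; rewrite AE.
by rewrite (_ : (fun g => _) = (fun g => (dotp (U g f) (adjoint A k))%:E))//;
  apply/funext => g; rewrite AE.
Qed.

(** If the weak integral exists, it supplies the joint integrability for Fubini. Moving [U g] and
    [A] to the other side turns the integral over [h] into [Q f], and the integral over [g] then
    gives the outer [Q]. *)
Lemma PlaraE A : nonexpansive A ->
  Plara act mu A = (fun=> 0) \/ Plara act mu A = Q \o A \o Q.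
Proof.
move=> cA.
have [E|wB] := @EoperatorP _ _ _ pi _ _ (mu \x mu)%E (fun gh => U gh.1 \o A \o U gh.2).
  by left.
right; rewrite -/(Pda act (mu \x mu)%E A) -/(Plara act mu A) in wB.
apply/funext => f; apply: (dot_inj H) => k.
have [i ->] := wB.2 f k.
rewrite /Rintegral -(integral12_prod_meas1 i) /fubini_F.
rewrite -[RHS]/(fine (dotp (Q (A (Q f))) k)%:E); congr fine.
have [j ->] := wQ.2 (A (Q f)) k.
rewrite fineK; last exact: (integrable_fin_num measurableT j).
apply: eq_integral => g _ /=.
rewrite [in RHS]dotp_Uop// [in RHS](nonexpansive_dot cA).
have [l ->] := wQ.2 f (adjoint A (U g^-1%g k)).
rewrite fineK; last exact: (integrable_fin_num measurableT l).
apply: eq_integral => h _ /=.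
by rewrite dotp_Uop// (nonexpansive_dot cA).
Qed.

Lemma Plara_gap A : markov_like A ->
  Num.max (gamma_gap (Pla act mu A)) (gamma_gap (Pra act mu A)) <=
  gamma_gap (Plara act mu A).
Proof.
move=> mA; have mQ := markov_like_average.
have [s0|/set0P s0] := eqVneq (@L20_sphere _ _ _ pi) set0.
  have max0 (x y z : R) : x = 0 -> y = 0 -> z = 0 -> Num.max x y <= z.
    by move=> -> -> ->; rewrite maxxx.
  exact: max0 (gamma_gap_empty _ s0) (gamma_gap_empty _ s0) (gamma_gap_empty _ s0).
rewrite (PlaE mA.1) (PraE mA.1).
have mQA := markov_like_comp mQ mA; have mAQ := markov_like_comp mA mQ.
have [->|->] := PlaraE mA.1.
  by rewrite ge_max !(le_trans (gamma_gap_le1 _) (gamma_gap0 s0))//; [exact: mAQ.1|exact: mQA.1].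
have := gamma_gap_comp mQA mQ; rewrite ge_max => /andP[gQA _].
have := gamma_gap_comp mQ mAQ; rewrite ge_max => /andP[_ gAQ].
rewrite ge_max; apply/andP; split; first exact: gQA.
by rewrite compA in gAQ; exact: gAQ.
Qed.

Section OneSided.
Variable A : L2 pi -> L2 pi.
Hypotheses (mA : markov_like A) (cA : compact_seq (A \o adjoint A)).
Hypothesis s0 : @L20_sphere _ _ _ pi !=set0.

Let mQA : markov_like (Q \o A) := markov_like_comp markov_like_average mA.

(** The adjoint of [Q A] is [A' Q], whose norm at [f] is that of [S] at [Q f], a vector of [V]: this
    is why only the size of [S] on [V] matters. *)
Let norm_adj (c : R) : 0 <= c ->
  (forall v, V v -> L20 v -> `|mult_sqrt A v| <= c * `|v|) ->
  1 - c <= gamma_gap (Q \o A).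
Proof.
move=> c0 Ac; have mQ := markov_like_average.
apply: gamma_gap_ge => // [|f Lf]; first exact: mQA.1.
rewrite (adjoint_comp mQ.1 mA.1) adjoint_average /= -(norm_mult_sqrt mA.1).
apply: le_trans (Ac _ (average_V f) (markov_like_L20 mQ Lf)) _.
by rewrite ler_wpM2l//; exact: mQ.1.2.
Qed.

Lemma one_sided_bound (gamma2 : R) : gamma_gap A < gamma2 -> gamma2 <= 1 ->
  (forall c, is_eigenvalue (fun f => f - mult_sqrt A f) c ->
    gamma_gap A < c -> c < 1 -> gamma2 <= c) ->
  let b := beta act (Wtilde A) in
  let bound := 1 - Num.sqrt (b * (1 - gamma_gap A) ^+ 2 + (1 - b) * (1 - gamma2) ^+ 2) in
  [/\ bound <= gamma_gap (Q \o A), gamma_gap A <= bound &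
      Wtilde A `&` V = [set 0] -> gamma_gap A < gamma_gap (Q \o A)].
Proof.
move=> g2gt g2le1 g2min b bound; have cV := closed_Vspace; split.
- by apply: norm_adj => [|v Vv Lv]; [exact: sqrtr_ge0|exact: norm_mult_sqrt_beta].
- exact: beta_bound_ge.
- move=> WV.
  have sp : 0 < 1 - gamma_gap A by rewrite subr_gt0 (lt_le_trans g2gt).
  have [|c cs cP] := strict_contraction mA cA cV sp.
    by move=> f Wf Vf; have : (Wtilde A `&` V) f by []; rewrite WV.
  (* The constant obtained may be negative, for instance when [V] meets [L20] only in 0; truncating
     at 0 still leaves it below [1 - gamma_gap A]. *)
  have : 1 - Num.max 0 c <= gamma_gap (Q \o A).
    apply: norm_adj => [|v Vv Lv]; first by rewrite le_max lexx.
    by rewrite (le_trans (cP _ Vv Lv))// ler_wpM2r// le_max lexx orbT.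
  by apply: lt_le_trans; rewrite ltrBrDr -ltrBrDl gt_max sp cs.
Qed.
End OneSided.
End Average.
End GroupAverage.

(** If [A' A f = (1 - c)^2 f] then [A A'] has the same eigenvalue at [A f], which is nonzero because
    [c < 1]. *)
Lemma gamma2_transfer d (T : measurableType d) (R : realType) (pi : probability T R)
    (A : L2 pi -> L2 pi) (c : R) : nonexpansive A ->
  is_eigenvalue (fun f => f - mult_sqrt (adjoint A) f) c -> c < 1 ->
  is_eigenvalue (fun f => f - mult_sqrt A f) c.
Proof.
move=> cA [f f0 fE] c1; have H := hilbert_L2 pi.
have cA' := nonexpansive_adjoint cA.
have Sf : mult_sqrt (adjoint A) f = (1 - c) *: f.
  by rewrite scalerBl scale1r -fE subKr.
have c10 : 0 < 1 - c by rewrite subr_gt0.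
have AAf : adjoint A (A f) = (1 - c) ^+ 2 *: f.
  have := mult_sqrtK cA' f; rewrite (adjointK (nonexpansive_bounded cA)) => <-.
  by rewrite Sf (linZ (linear_mult_sqrt cA')) Sf scalerA.
have SAf : mult_sqrt A (A f) = (1 - c) *: A f.
  apply: (positive_opBr H) => //; first exact: positive_mult_sqrt.
  by rewrite mult_sqrtK// AAf (linZ cA.1).
exists (A f); last by rewrite SAf scalerBl scale1r subKr.
apply/eqP => Af0; move/eqP: AAf; rewrite Af0 (lin0 cA'.1) eq_sym scaler_eq0.
by rewrite sqrf_eq0 gt_eqF// (negbTE f0).
Qed.

(** Positivity of the square root gives [c <= 1]. As [c] is above a nonnegative gap it is nonzero,
    so its eigenvector is orthogonal to the constants and [L20] is not trivial. *)
Lemma gamma2_facts d (T : measurableType d) (R : realType) (pi : probability T R)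
    (A : L2 pi -> L2 pi) (c : R) : markov_like A -> is_gamma2 A c ->
  c <= 1 /\ @L20_sphere _ _ _ pi !=set0.
Proof.
move=> mA [[f f0 fE] gc _]; have H := hilbert_L2 pi.
have Sf : mult_sqrt A f = (1 - c) *: f by rewrite scalerBl scale1r -fE subKr.
have [_ _ Sp] := positive_mult_sqrt mA.1.
split.
  have := Sp f; rewrite Sf (dotZr H) pmulr_lge0 ?subr_ge0//.
  by rewrite lt_def (dot_eq0 H) f0 (dot_ge0 H).
exists (`|f|^-1 *: f); apply: L20_sphere_scale => //.
have c0 : c != 0 by rewrite gt_eqF// (le_lt_trans (gamma_gap_ge0 mA)).
have : dotp (mult_sqrt A f) (L2class pi (fun=> 1)) = dotp f (L2class pi (fun=> 1)).
  by rewrite (mult_sqrt_sym mA.1) mult_sqrt1.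
rewrite Sf (dotZl H) mulrBl mul1r => /eqP; rewrite subr_eq addrC -subr_eq subrr eq_sym.
by rewrite mulf_eq0 (negbTE c0) => /eqP.
Qed.

Unset Implicit Arguments.
Set Strict Implicit.
Set Printing Implicit Defensive.

Theorem theorem3p2 (R : realType) (X : ptopologicalType)
    (G : topologicalGroupType) (act : G -> X -> X)
    (m : {measure set (borel X) -> \bar R}) (pi : probability (borel X) R)
    (mu : probability (borel G) R) (P : R.-pker (borel X) ~> (borel X)) :
  polish R X ->
  hausdorff_space G -> locally_compact [set: G] -> haar_measure mu ->
  measurable_action act ->
  invariant_measure act m -> has_density m pi ->
  invariant_measure act pi ->
  stationary pi P ->
  let T := kernel_operator pi P in
  compact_operator T ->
  (forall nu : probability (borel G * borel G)%type R,
     gamma_gap (Pda act nu T) >= gamma_gap T /\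
     lambda_gap (Pda act nu T) >= gamma_gap T) /\
  gamma_gap (Plara act mu T)
    >= Num.max (gamma_gap (Pla act mu T)) (gamma_gap (Pra act mu T)) /\
  (forall gamma2 : R, is_gamma2 T gamma2 ->
     (let b := beta act (Wtilde T) in
      let bound := 1 - Num.sqrt (b * (1 - gamma_gap T) ^+ 2
                                 + (1 - b) * (1 - gamma2) ^+ 2) in
      [/\ gamma_gap (Pla act mu T) >= bound,
          bound >= gamma_gap T &
          Wtilde T `&` Vspace act pi = [set 0] ->
          gamma_gap (Pla act mu T) > gamma_gap T]) /\
     (let b' := beta act (Wtilde (adjoint T)) in
      let bound' := 1 - Num.sqrt (b' * (1 - gamma_gap T) ^+ 2
                                  + (1 - b') * (1 - gamma2) ^+ 2) in
      [/\ gamma_gap (Pra act mu T) >= bound',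
          bound' >= gamma_gap T &
          Wtilde (adjoint T) `&` Vspace act pi = [set 0] ->
          gamma_gap (Pra act mu T) > gamma_gap T])).
Proof.
move=> _ _ _ hmu mact _ _ ipi statP T cT.
have mT : markov_like T.
  split; last exact: kernel_operator1.
  (* Linearity is read off [compact_operator]. *)
  by split; [exact: cT.1.1|exact: kernel_operator_nonexpansive].
have mT' := markov_like_adjoint mT.
have TK : adjoint (adjoint T) = T := adjointK (nonexpansive_bounded mT.1).
have [Q [Ql Q1 QE]] := exists_average mact ipi mu.
have wQ : is_weak_integral mu (fun g => @Uop R X G act pi g) Q.
  split; first exact: nonexpansive_bounded.
  by move=> f h; split; [exact: integrable_dotp_Uop|exact: QE].
split; first by move=> nu; exact: Pda_gaps.
split; first exact: (Plara_gap mact ipi wQ mT).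
move=> gamma2 g2; have [g2le1 s0] := gamma2_facts mT g2.
have [_ g2gt g2min] := g2.
have sT := compact_operator_seq cT.
split.
- rewrite (PlaE mact ipi wQ mT.1).
  apply: (one_sided_bound mact ipi hmu wQ mT _ s0 g2gt g2le1).
    exact: compact_seq_compr mT'.1 sT.
  by move=> c ec gc _; exact: g2min.
- rewrite (PraE mact ipi wQ mT.1).
  (* [T Q] is the adjoint of [Q T'], so the right average reduces to the left average of
     [adjoint T]. *)
  have -> : gamma_gap (T \o Q) = gamma_gap (Q \o adjoint T).
    have mQ := markov_like_average mact ipi wQ.
    rewrite -(gamma_gap_adjoint (markov_like_comp mQ mT')).
    by rewrite (adjoint_comp mQ.1 mT'.1) (adjoint_average mact ipi hmu wQ) TK.
  have gE := gamma_gap_adjoint mT; rewrite -gE.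
  apply: (one_sided_bound mact ipi hmu wQ mT' _ s0) => //.
  + by rewrite TK; exact: compact_seq_compl mT'.1 sT.
  + by rewrite gE.
  + by move=> c ec gc c1; apply: g2min; [exact: gamma2_transfer mT.1 ec c1|rewrite -gE].
Qed.
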